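(* Let $M$ be an orientable 3-dimensional smooth manifold. The following assertions are equivalent: (1) $M$ admits a coKähler structure; (2) there exists a Riemannian metric $g$ on $M$ such that the gauge equation of the Levi-Civita connection $\nabla^{lc}$ of $g$ admits a non-zero skew-symmetric solution; that is, there is a non-zero $(1,1)$-tensor field $\theta$ with $g(\theta X,Y)=-g(X,\theta Y)$ for all vector fields $X,Y$ and $\nabla^{lc}\theta=0$.
   Context: An almost contact metric structure on $M$ is a quadruple $(\theta,\xi,\eta,g)$ where $\theta$ is a $(1,1)$-tensor field, $\xi$ a vector field, $\eta$ a 1-form and $g$ a Riemannian metric such that $\eta(\xi)=1$, $\theta^2=-\mathrm{Id}+\eta\otimes\xi$ and $g(\theta X,\theta Y)=g(X,Y)-\eta(X)\eta(Y)$. Its fundamental 2-form is $\Omega(X,Y)=g(\theta X,Y)$. It is cosymplectic if $d\eta=0$ and $d\Omega=0$. It is normal if $N_\theta+d\eta\otimes\xi=0$, where $N_\theta(X,Y)=\theta^2[X,Y]-\theta([\theta X,Y]+[X,\theta Y])+[\theta X,\theta Y]$. A coKähler structure is an almost contact metric structure that is cosymplectic and normal. For the Levi-Civita connection (which is self-dual) the gauge equation $\nabla^*_X(\theta Y)=\theta(\nabla_XY)$ is $\nabla^{lc}\theta=0$.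
   Formalization: The manifold M is additionally assumed connected (and non-empty); without this the claim fails, e.g. for the disjoint union of a flat 3-torus and a 3-sphere, with θ parallel and non-zero on the torus and zero on the sphere. *)

(* Defs.v *)
From HB Require Import structures.
From mathcomp Require Import all_boot all_order all_algebra.
From mathcomp Require Import all_classical all_reals all_analysis.
From mathcomp Require Import ring.
Import Order.TTheory GRing.Theory Num.Theory numFieldNormedType.Exports.

Set Implicit Arguments.
Unset Strict Implicit.
Unset Printing Implicit Defensive.

Local Open Scope classical_set_scope.
Local Open Scope ring_scope.

(* C^k and smooth maps on an open set U of R^n.  As n is finite, the regularity
   of x |-> 'd f x can be tested on each vector v separately. *)
Section Smooth.
Context {R : realType} {n : nat} {W : normedModType R}.
Implicit Types (U : set 'rV[R]_n) (f g : 'rV[R]_n -> W).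

Fixpoint Ck k U f : Prop :=
  if k is k'.+1 then
    (forall x, U x -> differentiable f x) /\
    (forall v, Ck k' U (fun x => 'd f x v))
  else forall x, U x -> {for x, continuous f}.

Definition smooth_on U f := forall k, Ck k U f.

Lemma diff_near_eq f g x : (\forall y \near x, f y = g y) ->
  differentiable f x -> differentiable g x /\ 'd g x = 'd f x :> (_ -> _).
Proof.
move=> fg df; have fgx : f x = g x := nbhs_singleton fg.
have cdf : continuous ('d f x) := diff_continuous df.
have gE : g \o shift x = cst (g x) + 'd f x +o_ 0 id.
  apply/eqaddoP => _/posnumP[e].
  have /eqaddoP/(_ e%:num (gt0 e)) := diff_locally df.
  have fg0 : \forall y \near 0, f (y + x) = g (y + x).
    by move: fg; rewrite (near_shift 0)/= => fg; apply: filterS fg => y /=;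
      rewrite subr0.
  by apply: filterS2 fg0 => y E; rewrite !fctE /= E fgx.
have dE := diff_unique cdf gE.
by split=> //; apply/diff_locallyP; rewrite dE; split.
Qed.

Lemma Ck_ext k U f g : open U -> (forall x, U x -> f x = g x) ->
  Ck k U f -> Ck k U g.
Proof.
move=> oU; elim: k f g => [|k IH] f g fg /=.
  move=> cf x Ux; have nfg : \forall y \near x, f y = g y.
    by apply: filterS (open_nbhs_nbhs (conj oU Ux)); exact: fg.
  rewrite /prop_for /continuous_at -(fg x Ux); apply: cvg_trans (cf x Ux).
  exact: near_eq_cvg nfg.
move=> [df Cf].
have H x : U x -> differentiable g x /\ 'd g x = 'd f x :> (_ -> _).
  move=> Ux; apply: diff_near_eq (df x Ux).
  by apply: filterS (open_nbhs_nbhs (conj oU Ux)); exact: fg.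
split=> [x Ux|v]; first by have [] := H x Ux.
by apply: IH (Cf v) => x Ux; have [_ ->] := H x Ux.
Qed.

Lemma Ck_cst k U (a : W) : Ck k U (cst a).
Proof.
elim: k a => [|k IH] a /=; first by move=> x _; exact: cst_continuous.
split=> [x _|v]; first exact: differentiable_cst.
rewrite (_ : (fun x => _) = cst 0)//; apply/funext => x.
by rewrite diff_cst.
Qed.

Lemma CkD k U f g : open U -> Ck k U f -> Ck k U g -> Ck k U (f + g).
Proof.
move=> oU; elim: k f g => [|k IH] f g /=.
  by move=> cf cg x Ux; apply: continuousD; [exact: cf|exact: cg].
move=> [df Cf] [dg Cg]; split=> [x Ux|v].
  by apply: differentiableD; [exact: df|exact: dg].
apply: Ck_ext (IH _ _ (Cf v) (Cg v)) => // x Ux.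
exact/esym/(congr1 (@^~ v) (diffD (df _ Ux) (dg _ Ux))).
Qed.

Lemma CkS k U f : Ck k.+1 U f -> Ck k U f.
Proof.
elim: k f => [|k IH] f [df Cf].
  by move=> x Ux; apply: differentiable_continuous; exact: df.
by split=> // v; apply: IH; exact: Cf.
Qed.

End Smooth.

Section SmoothMul.
Context {R : realType} {n : nat}.
Implicit Types (U : set 'rV[R]_n) (f g : 'rV[R]_n -> R).

Lemma CkM k U f g : open U -> Ck k U f -> Ck k U g -> Ck k U (f * g).
Proof.
move=> oU; elim: k f g => [|k IH] f g.
  by move=> cf cg x Ux; apply: continuousM; [exact: cf|exact: cg].
move=> Cf' Cg'; have [df Cf] := Cf'; have [dg Cg] := Cg'.
split=> [x Ux|v]; first by apply: differentiableM; [exact: df|exact: dg].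
have := CkD oU (IH _ _ (CkS Cf') (Cg v)) (IH _ _ (CkS Cg') (Cf v)).
apply: Ck_ext => // x Ux.
exact/esym/(congr1 (@^~ v) (diffM (df _ Ux) (dg _ Ux))).
Qed.

End SmoothMul.

Record chart (R : realType) (n : nat) (T : topologicalType) := Chart {
  dom : set T;
  cod : set 'rV[R]_n;
  coord : T -> 'rV[R]_n;
  param : 'rV[R]_n -> T;
  dom_open : open dom;
  cod_open : open cod;
  coord_cod : forall p, dom p -> cod (coord p);
  param_dom : forall x, cod x -> dom (param x);
  coordK : forall p, dom p -> param (coord p) = p;
  paramK : forall x, cod x -> coord (param x) = x;
  coord_cont : forall p, dom p -> {for p, continuous coord};
  param_cont : forall x, cod x -> {for x, continuous param} }.

Arguments cod_open {R n T} c.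

Definition transition (R : realType) n T (c d : chart R n T) :=
  coord d \o param c.

Definition smooth_transition (R : realType) n T (c d : chart R n T) :=
  smooth_on (cod c `&` param c @^-1` dom d) (transition c d).

Definition smooth_atlas (R : realType) n T (A : set (chart R n T)) :=
  (forall p, exists2 c, A c & dom c p) /\
  (forall c d, A c -> A d -> smooth_transition c d).

(* The atlas is not required to be maximal. *)
Record manifold (R : realType) (n : nat) := Manifold {
  carrier :> topologicalType;
  atlas : set (chart R n carrier);
  atlas_smooth : smooth_atlas atlas;
  manifold_nonempty : [set: carrier] !=set0;
  manifold_hausdorff : hausdorff_space carrier;
  manifold_second_countable : @second_countable carrier }.

(* A second atlas A of the same smooth structure, all of whose transition maps
   have positive Jacobian determinant. *)
Definition orientable (R : realType) n (M : manifold R n) :=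
  exists A : set (chart R n M),
    [/\ smooth_atlas A,
        forall c d, A c -> atlas d ->
          smooth_transition c d /\ smooth_transition d c &
        forall c d p, A c -> A d -> dom c p -> dom d p ->
          0 < \det ('J (transition c d) (coord c p))].

Section SmoothFunctions.
Context {R : realType} {n : nat} (M : manifold R n).

Definition smooth : {pred M -> R} := fun f =>
  `[< forall c, atlas c -> smooth_on (cod c) (f \o @param R n M c) >].

Lemma smooth_cst a : cst a \in smooth.
Proof. by apply/asboolP => c Ac k; exact: Ck_cst. Qed.

Fact smooth_subring : subring_closed smooth.
Proof.
split=> [|f g /asboolP Sf /asboolP Sg|f g /asboolP Sf /asboolP Sg].
- exact: (smooth_cst 1).
- apply/asboolP => c Ac k; have oc := cod_open c.
  rewrite (_ : _ \o _ = f \o param c + cst (-1) * (g \o param c)).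
    exact: CkD oc (Sf c Ac k) (CkM oc (Ck_cst _ _ _) (Sg c Ac k)).
  by apply/funext => x; rewrite !fctE /= mulN1r.
- by apply/asboolP => c Ac k; exact: (CkM (cod_open c) (Sf c Ac k) (Sg c Ac k)).
Qed.

HB.instance Definition _ :=
  GRing.isSubringClosed.Build (M -> R) smooth smooth_subring.

Fact smooth_scale : GRing.scaler_closed smooth.
Proof. by move=> a f Sf; exact: (rpredM (smooth_cst a) Sf). Qed.

HB.instance Definition _ :=
  GRing.isScaleClosed.Build R (M -> R) smooth smooth_scale.

Record smoothFun :=
  SmoothFun { smooth_fun :> M -> R; smooth_funP : smooth_fun \in smooth }.

HB.instance Definition _ := [isSub for smooth_fun].
HB.instance Definition _ := [Choice of smoothFun by <:].
HB.instance Definition _ := 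
  GRing.SubChoice_isSubComPzRing.Build (M -> R) smooth smoothFun smooth_subring.
HB.instance Definition _ := [SubZmodule_isSubLmodule of smoothFun by <:].

Lemma smoothFunP (f g : smoothFun) : f =1 g -> f = g.
Proof. by move=> fg; apply/val_inj/funext. Qed.

Lemma smooth_scaleAr a (f g : smoothFun) : f * (a *: g) = a *: (f * g).
Proof. by apply: smoothFunP => p; exact: mulrCA. Qed.

End SmoothFunctions.

(* Vector fields are the derivations of the R-algebra of smooth functions.
   They form a module over this algebra, and tensor fields are the maps on
   vector fields that are linear over it in each argument. *)
Section VectorFields.
Context {R : realType} {n : nat} (M : manifold R n).
Local Notation C := (smoothFun M).

Definition derivation : {pred C -> C^o} := fun D =>
  `[< (forall (a : R) (f g : C), D (a *: f + g) = a *: (D f : C) + (D g : C)) /\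
      (forall f g : C, D (f * g) = D f * g + f * D g) >].

Fact derivation_submod : submod_closed derivation.
Proof.
split=> [|h D E /asboolP[linD mulD] /asboolP[linE mulE]].
  apply/asboolP; split=> [a f g|f g] /=; first by rewrite scaler0 addr0.
  by rewrite mul0r mulr0 addr0.
have scaleE (u : C) (v : C^o) : u *: v = u * v :> C by [].
apply/asboolP; split=> [a f g|f g]; rewrite !fctE /= !scaleE.
  by rewrite linD linE mulrDr smooth_scaleAr scalerDr addrACA.
rewrite mulD mulE !mulrDl !mulrDr !mulrA (mulrC f h).
by rewrite addrACA.
Qed.

HB.instance Definition _ :=
  GRing.isSubmodClosed.Build C (C -> C^o) derivation derivation_submod.

Record vectorField :=
  VectorField { vf_fun :> C -> C^o; vf_funP : vf_fun \in derivation }.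

HB.instance Definition _ := [isSub for vf_fun].
HB.instance Definition _ := [Choice of vectorField by <:].
HB.instance Definition _ := [SubChoice_isSubLmodule of vectorField by <:].

Lemma derivationP (X : vectorField) :
  (forall (a : R) (f g : C), X (a *: f + g) = a *: (X f : C) + (X g : C)) /\
  (forall f g : C, X (f * g) = X f * g + f * X g).
Proof. exact/asboolP/vf_funP. Qed.

Fact lie_subproof (X Y : vectorField) :
  (fun f => X (Y f) - Y (X f)) \in derivation.
Proof.
have [linX mulX] := derivationP X; have [linY mulY] := derivationP Y.
have addX f g : X (f + g) = X f + X g by have := linX 1 f g; rewrite !scale1r.
have addY f g : Y (f + g) = Y f + Y g by have := linY 1 f g; rewrite !scale1r.
apply/asboolP; split=> [a f g|f g].
  by rewrite linX linY linX linY opprD addrACA scalerBr.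
rewrite mulX mulY addX addY !mulX !mulY opprD mulrBl mulrBr.
rewrite !opprD !addrA.
move: (_ * g) (_ * g) (f * _) (f * _) (Y f * _) (X f * _) => a b c d u v.
by apply: smoothFunP => p /=; rewrite /GRing.add /GRing.opp /=; ring.
Qed.

Definition lie (X Y : vectorField) : vectorField :=
  VectorField (lie_subproof X Y).

(* A (1,1)-tensor field is an element of endo. *)
Definition form1 := {linear vectorField -> C^o}.
Definition endo := {linear vectorField -> vectorField}.

(* X does not vanish at p iff (X f) p <> 0 for some smooth f. *)
Record riemannian_metric := RiemannianMetric {
  metric :> vectorField -> vectorField -> C;
  metric_linear : forall (f : C) X Y Z,
    metric (f *: X + Y) Z = f * metric X Z + metric Y Z;
  metric_sym : forall X Y, metric X Y = metric Y X;
  metric_pos : forall (X : vectorField) (p : M),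
    (exists f, (X f : C) p != 0) -> 0 < metric X X p }.

Record affine_connection := AffineConnection {
  nabla :> vectorField -> vectorField -> vectorField;
  nabla_linear : forall (f : C) X Y Z,
    nabla (f *: X + Y) Z = f *: nabla X Z + nabla Y Z;
  nabla_additive : forall X Y Z, nabla X (Y + Z) = nabla X Y + nabla X Z;
  nabla_leibniz : forall (f : C) X Y,
    nabla X (f *: Y) = (X f : C) *: Y + f *: nabla X Y }.

Implicit Types X Y Z : vectorField.

Definition torsion_free (D : affine_connection) :=
  forall X Y, D X Y - D Y X = lie X Y.

Definition metric_connection (g : riemannian_metric) (D : affine_connection) :=
  forall X Y Z, X (g Y Z) = g (D X Y) Z + g Y (D X Z).

Definition levi_civita g D := torsion_free D /\ metric_connection g D.

Definition skew_symmetric (g : riemannian_metric) (theta : endo) :=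
  forall X Y, g (theta X) Y = - g X (theta Y).

(* (D_X theta) Y *)
Definition cov_endo (D : affine_connection) (theta : endo) X Y :=
  D X (theta Y) - theta (D X Y).

Definition parallel D theta := forall X Y, cov_endo D theta X Y = 0.

(* Exterior derivatives of 1-forms and 2-forms, with no factor 1/2 or 1/3. *)
Definition d1 (eta : form1) X Y : C :=
  X (eta Y) - Y (eta X) - eta (lie X Y).

Definition d2 (Omega : vectorField -> vectorField -> C) X Y Z : C :=
  X (Omega Y Z) + Y (Omega Z X) + Z (Omega X Y)
  - Omega (lie X Y) Z - Omega (lie Y Z) X - Omega (lie Z X) Y.

Definition nijenhuis (theta : endo) X Y :=
  theta (theta (lie X Y)) - theta (lie (theta X) Y + lie X (theta Y))
  + lie (theta X) (theta Y).

Record almost_contact_metric := AlmostContactMetric {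
  acm_theta :> endo;
  acm_xi : vectorField;
  acm_eta : form1;
  acm_g : riemannian_metric;
  acm_eta_xi : acm_eta acm_xi = 1;
  acm_theta2 : forall X, acm_theta (acm_theta X) = - X + acm_eta X *: acm_xi;
  acm_compat : forall X Y, acm_g (acm_theta X) (acm_theta Y) =
    acm_g X Y - acm_eta X * acm_eta Y }.

Definition fundamental_form (S : almost_contact_metric) X Y : C :=
  acm_g S (acm_theta S X) Y.

Definition cosymplectic (S : almost_contact_metric) :=
  (forall X Y, d1 (acm_eta S) X Y = 0) /\
  (forall X Y Z, d2 (fundamental_form S) X Y Z = 0).

Definition normal (S : almost_contact_metric) :=
  forall X Y,
    nijenhuis (acm_theta S) X Y + d1 (acm_eta S) X Y *: acm_xi S = 0.

Definition coKahler S := cosymplectic S /\ normal S.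

End VectorFields.

(* Main.v *)
From HB Require Import structures.
From mathcomp Require Import all_boot all_order all_algebra.
From mathcomp Require Import all_classical all_reals all_analysis.
From mathcomp Require Import ring lra.
Require Import Defs.
Import Order.TTheory GRing.Theory Num.Theory numFieldNormedType.Exports.

Set Implicit Arguments.
Unset Strict Implicit.
Unset Printing Implicit Defensive.

Local Open Scope classical_set_scope.
Local Open Scope ring_scope.

(* A skew-symmetric parallel theta on an oriented 3-manifold is theta Y = v x Y
   for a global vector field v, and theta^2 Y = - |v|^2 Y + g (v, Y) v.
   Differentiating this identity and taking its trace shows that |v|^2 is
   constant and v parallel, so (theta, v, g v) is coKahler after a constant
   rescaling.  Conversely, with T X Y Z = g ((D_X theta) Y) Z and
   h X Y = g (D_X xi) Y, the conditions d Omega = 0, d eta = 0 and normality are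
   linear relations between T and h that force h = 0 and then T = 0.

   As vector fields are derivations, their locality and their expansion in
   coordinate frames rest on bump functions and on Hadamard's lemma. *)

(** * Maps of class C^k *)

(** The cross-product formula for [v] is read in an orthonormal frame and changes sign with the
    orientation of that frame; the positive Jacobians of the oriented atlas make the local choices
    agree. Also, [theta] is only known to be non-zero somewhere: connectedness carries the
    positivity of |v|^2 from one point to all of [M], which is what permits the division by |v|.

    Global vector fields are not assembled with partitions of unity. They are prescribed by a
    condition at each point that has local smooth solutions and determines the tangent vector there
    ([glue_fields]). The axis [v] arises in this way, and so does the Levi-Civita connection,
    through the duality [sharp] applied to the Koszul expression.

    Identities between vector fields are pulled back to real numbers by pairing with an arbitrary
    field at an arbitrary point, where [ring] and [lra] finish. *)

Lemma diff_coord {R : realType} {n : nat} (x : 'rV[R]_n) j :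
  'd (fun z : 'rV[R]_n => z 0 j) x = (fun z : 'rV[R]_n => z 0 j) :> (_ -> _).
Proof.
have @L : {linear 'rV[R]_n -> R}.
  by exists (fun z : 'rV[R]_n => z 0 j); do 2![eexists]; do ?[constructor];
    rewrite ?mxE// => ? *; rewrite ?mxE//; move=> ?; rewrite !mxE.
rewrite (_ : (fun z : 'rV[R]_n => z 0 j) = L)//.
exact/diff_lin/coord_continuous.
Qed.

Section CkTheory.
Context {R : realType} {n : nat}.
Implicit Types U V : set 'rV[R]_n.

Lemma Ck_sub {W : normedModType R} k U V (f : 'rV[R]_n -> W) :
  V `<=` U -> Ck k U f -> Ck k V f.
Proof.
move=> VU; elim: k f => [|k IH] f /=; first by move=> cf x /VU; exact: cf.
by move=> [df Cf]; split=> [x /VU|v]; [exact: df|exact: IH (Cf v)].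
Qed.

Lemma Ck0 {W : normedModType R} k U (f : 'rV[R]_n -> W) : Ck k U f -> Ck 0 U f.
Proof. by elim: k f => [//|k IH] f /CkS; exact: IH. Qed.

Lemma Ck_local {W : normedModType R} k U (f : 'rV[R]_n -> W) :
  (forall x, U x -> exists V, [/\ open V, V x & Ck k V f]) -> Ck k U f.
Proof.
elim: k f => [|k IH] f /= H; first by move=> x /H[V [_ Vx]]; apply.
split=> [x /H[V [_ Vx []]]|v]; first by move=> + _; apply.
by apply: IH => x /H[V [oV Vx [_ Cf]]]; exists V; split.
Qed.

Lemma diff_coordE {W : normedModType R} (f : 'rV[R]_n -> W) x v :
  'd f x v = \sum_i v 0 i *: 'd f x (delta_mx 0 i).
Proof.
rewrite {1}(row_sum_delta v) linear_sum; apply: eq_bigr => i _.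
by rewrite linearZ.
Qed.

Lemma Ck_big (I : finType) k U (F : I -> 'rV[R]_n -> R) : open U ->
  (forall i, Ck k U (F i)) -> Ck k U (fun x => \sum_i F i x).
Proof.
move=> oU CF; rewrite (_ : (fun x => _) = \sum_i F i); last first.
  by apply/funext => x; rewrite fct_sumE.
by elim/big_ind: _ => //; [exact: (Ck_cst k U 0)|move=> *; exact: CkD].
Qed.

Lemma Ck_prod (I : finType) k U (F : I -> 'rV[R]_n -> R) : open U ->
  (forall i, Ck k U (F i)) -> Ck k U (fun x => \prod_i F i x).
Proof.
move=> oU CF; suff H (s : seq I) : Ck k U (fun x => \prod_(i <- s) F i x) by [].
elim: s => [|i s IH].
  rewrite (_ : (fun _ => _) = cst 1); first exact: Ck_cst.
  by apply/funext => x; rewrite big_nil.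
rewrite (_ : (fun _ => _) = F i * (fun x => \prod_(i <- s) F i x)).
  exact: CkM.
by apply/funext => x; rewrite big_cons.
Qed.

Lemma Ck_coord {m} k U (g : 'rV[R]_n -> 'rV[R]_m) j :
  open U -> Ck k U g -> Ck k U (fun x => g x 0 j).
Proof.
move=> oU; elim: k g => [|k IH] g /=.
  move=> cg x Ux; apply: (@continuous_comp _ _ _ g (fun y => y 0 j)).
    exact: cg.
  exact: coord_continuous.
move=> [dg Cg].
have dc (y : 'rV[R]_m) : differentiable (fun z : 'rV[R]_m => z 0 j : R^o) y.
  exact: differentiable_coord.
have dE x : U x -> forall v, 'd (fun x => g x 0 j) x v = 'd g x v 0 j.
  move=> Ux v; have := diff_comp (dg x Ux) (dc (g x)).
  rewrite /comp => ->; rewrite /= diff_coord.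
  done.
split=> [x Ux|v]; first exact: (differentiable_comp (dg x Ux) (dc _)).
by apply: Ck_ext (IH _ (Cg v)) => // x Ux; rewrite dE.
Qed.

End CkTheory.

Section CkComposition.
Context {R : realType}.

Lemma Ck_comp {n m} k (U : set 'rV[R]_n) (V : set 'rV[R]_m)
    (g : 'rV[R]_n -> 'rV[R]_m) (f : 'rV[R]_m -> R) :
  open U -> (forall x, U x -> V (g x)) -> Ck k U g -> Ck k V f ->
  Ck k U (f \o g).
Proof.
move=> oU gV; elim: k f => [|k IH] f.
  move=> cg cf x Ux; apply: continuous_comp; first exact: cg.
  exact/cf/gV.
move=> Cg [df Cf]; have [dg Cg'] := Cg.
split=> [x Ux|v]; first by apply: differentiable_comp; [exact: dg|exact/df/gV].
(* The chain rule in coordinates: every summand is a directional derivative of [g] times a partial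
   derivative of [f] composed with [g], so the induction hypothesis is used on the partial
   derivatives of [f], with the same [g]. *)
pose F j x := 'd g x v 0 j * 'd f (g x) (delta_mx 0 j).
apply: (@Ck_ext _ _ _ _ _ (fun x => \sum_j F j x)) => // [x Ux|].
  rewrite (diff_comp (dg x Ux) (df _ (gV _ Ux))) /= [RHS]diff_coordE.
  by apply: eq_bigr.
apply: Ck_big => // j; apply: CkM => //; first exact: Ck_coord (Cg' v).
exact: IH (CkS Cg) (Cf _).
Qed.

Context {n : nat}.
Implicit Types (U : set 'rV[R]_n) (f : 'rV[R]_n -> R).

Lemma CkN k U f : open U -> Ck k U f -> Ck k U (- f).
Proof.
move=> oU Cf; rewrite (_ : - f = cst (-1) * f); first exact/CkM/Cf/Ck_cst.
by apply/funext => x; rewrite !fctE mulN1r.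
Qed.

Lemma CkB k U f g : open U -> Ck k U f -> Ck k U g -> Ck k U (f - g).
Proof. by move=> oU Cf Cg; apply: CkD => //; exact: CkN. Qed.

(** The derivative of 1/f is -(1/f)^2 df, so 1/f reappears in it one order lower; this makes
    induction on [k] work. The square root is treated in the same way, its derivative being df / (2
    sqrt f). *)
Lemma CkV k U f : open U -> (forall x, U x -> f x != 0) -> Ck k U f ->
  Ck k U (fun x => (f x)^-1).
Proof.
move=> oU f0; elim: k => [|k IH].
  by move=> cf x Ux; apply: continuousV; [exact: f0|exact: cf].
move=> Cf; have [df Cf'] := Cf.
split=> [x Ux|v]; first by apply: differentiableV; [exact: df|exact: f0].
have CV := IH (CkS Cf).
have := CkN oU (CkM oU (CkM oU CV CV) (Cf' v)).
apply: (Ck_ext oU) => x Ux; apply: esym.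
apply: etrans (congr1 (@^~ v) (diffV (df x Ux) (f0 x Ux))) _.
by rewrite !fctE /= -expr2 exprVn; exact: scaleNr.
Qed.

Lemma diff_sqrt f x : differentiable f x -> 0 < f x ->
  differentiable (fun y => Num.sqrt (f y)) x /\
  'd (fun y => Num.sqrt (f y)) x =
    (fun v => (2 * Num.sqrt (f x))^-1 * 'd f x v) :> (_ -> _).
Proof.
move=> df f0; have ds := is_derive1_sqrt f0.
have dd : differentiable (@Num.sqrt R) (f x).
  by apply/derivable1_diffP; case: ds.
split; first exact: differentiable_comp.
rewrite [LHS](diff_comp df dd); apply/funext => v /=.
rewrite deriv1E ?derive1E; last exact/derivable1_diffP.
by rewrite derive_sqrt// /GRing.scale /= mulrC.
Qed.

Lemma Ck_sqrt k U f : open U -> (forall x, U x -> 0 < f x) -> Ck k U f ->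
  Ck k U (fun x => Num.sqrt (f x)).
Proof.
move=> oU f0; elim: k => [|k IH].
  move=> cf x Ux; apply: continuous_comp; first exact: cf.
  exact: sqrt_continuous.
move=> Cf; have [df Cf'] := Cf.
split=> [x Ux|v]; first by have [] := diff_sqrt (df x Ux) (f0 x Ux).
have C2 : Ck k U (fun x => 2 * Num.sqrt (f x)).
  by have := CkM oU (Ck_cst k U (2 : R)) (IH (CkS Cf)).
have CV : Ck k U (fun x => (2 * Num.sqrt (f x))^-1).
  apply: CkV => // x /f0 fx.
  by rewrite mulf_neq0// ?pnatr_eq0// gt_eqF// sqrtr_gt0.
apply: (Ck_ext oU _ (CkM oU CV (Cf' v))) => x Ux; apply: esym.
by have [_ /(congr1 (@^~ v))] := diff_sqrt (df x Ux) (f0 x Ux).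
Qed.

End CkComposition.

(** * Bump functions *)

Section FlatFunction.
Context {R : realType}.
Implicit Types (m : nat) (t : R).

Lemma Ck_id {n} k (U : set 'rV[R]_n) : Ck k U id.
Proof.
case: k => [|k]; first by move=> x _; exact: cvg_id.
split=> // v; rewrite (_ : (fun _ => _) = cst v); first exact: Ck_cst.
by apply/funext => x; rewrite diff_val.
Qed.

Lemma rV_norm_coord {n} (x : 'rV[R]_n) i : `|x 0 i| <= `|x|.
Proof.
rewrite [leRHS]/Num.norm /= mx_normrE.
by apply/bigmax_geP; right; exists (0, i).
Qed.

Lemma rV_norm_attained {n} (x : 'rV[R]_n) e : 0 < e -> e <= `|x| ->
  exists i, e <= `|x 0 i|.
Proof.
rewrite [leRHS]/Num.norm /= mx_normrE => e0 /bigmax_geP[|[[j i] _ /=]].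
  by rewrite leNgt e0.
by rewrite (ord1 j); exists i.
Qed.

(* The derivatives of t |-> exp (-1/t), extended by 0 for t <= 0, are
   combinations of these functions. *)
Definition flat m t : R := if 0 < t then t^-1 ^+ m * expR (- t^-1) else 0.

Lemma flat_gt0 m t : 0 < t -> 0 < flat m t.
Proof.
by move=> t0; rewrite /flat t0 mulr_gt0 ?expR_gt0 ?exprn_gt0 ?invr_gt0.
Qed.

Lemma flat_le0 m t : t <= 0 -> flat m t = 0.
Proof. by move=> t0; rewrite /flat ltNge t0. Qed.

Lemma flat_ge0 m t : 0 <= flat m t.
Proof. by case: (leP t 0) => [/flat_le0->//|/flat_gt0/ltW]. Qed.

(** With s = 1/t, the exponential series gives exp s >= s^(m+2) / (m+2)!. Two powers of t are kept
    so that the difference quotient of [flat m] at 0 still tends to 0. *)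
Lemma flat_bound m t : flat m t <= (m.+2)`!%:R * t ^+ 2.
Proof.
have [t0|t0] := leP t 0; first by rewrite flat_le0// mulr_ge0// sqr_ge0.
rewrite /flat t0 expRN; set s := t^-1.
have s0 : 0 < s by rewrite invr_gt0.
have F0 : 0 < (m.+2)`!%:R :> R by rewrite ltr0n fact_gt0.
have := expR_ge1Dxn m.+1 (ltW s0).
have -> : t ^+ 2 = s ^- 2 by rewrite /s exprVn invrK.
rewrite ler_pdivrMr ?expR_gt0// => H.
rewrite mulrAC ler_pdivlMr ?exprn_gt0// -exprD addn2.
rewrite mulrC -ler_pdivrMr// .
by apply: le_trans H; rewrite lerDr.
Qed.

Lemma is_derive_flat m t :
  is_derive t 1 (flat m) (flat m.+2 t - m%:R * flat m.+1 t).
Proof.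
have [t0|t0|->] := ltgtP t 0.
- rewrite !flat_le0 ?(ltW t0)// mulr0 subr0.
  have E : \forall x \near t, cst 0 x = flat m x.
    by near=> x; rewrite flat_le0//; apply/ltW; near: x; exact: lt_nbhsl.
  by apply: (near_eq_is_derive E); exact: is_derive_cst.
- have E : \forall x \near t, x^-1 ^+ m * expR (- x^-1) = flat m x.
    by near=> x; rewrite /flat ifT//; near: x; exact: lt_nbhsr.
  apply: (near_eq_is_derive E).
  have tn0 : t != 0 by rewrite gt_eqF.
  have dV : is_derive t 1 (@GRing.inv R) (- t ^- 2).
    have d1 : derivable (@id R) t 1 by exact: derivable_id.
    apply: (DeriveDef (@derivableV _ _ (@id R) _ _ tn0 d1)).
    by rewrite (@deriveV _ _ (@id R) _ _ tn0 d1) derive_id [_ *: 1]mulr1.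
  have dE : is_derive t 1 (fun x => expR (- x^-1)) (t ^- 2 * expR (- t^-1)).
    have dN : is_derive t 1 (fun x : R => - x^-1) (t ^- 2).
      by apply: is_derive_eq; rewrite opprK.
    have := @is_derive1_comp R expR _ _ _ _ (is_derive_expR _) dN.
    by rewrite mulrC.
  have dX : is_derive t 1 (fun x : R => x^-1 ^+ m) (- (m%:R * t^-1 ^+ m.+1)).
    case: m {E} => [|m].
      rewrite mul0r oppr0 (_ : (fun _ => _) = cst 1).
        exact: is_derive_cst.
      by apply/funext => x; rewrite expr0.
    rewrite (_ : (fun x : R => _) = (@GRing.inv R) ^+ m.+1); last first.
      by apply/funext => x; rewrite exprfctE.
    apply: is_derive_eq.
    by rewrite /GRing.scale /= mulrN -mulrA -exprVn -exprD addn2.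
  have [D1 D2] := is_deriveM dX dE; apply: (DeriveDef D1); apply: etrans D2 _.
  rewrite /flat t0 /GRing.scale /= -exprVn !exprS; ring.
- rewrite !flat_le0// mulr0 subr0.
  suff L : h^-1 *: (flat m (h *: 1 + 0) - flat m 0) @[h --> 0^'] --> (0 : R).
    by split; [apply/cvg_ex; exists 0|apply/cvg_lim].
  set C : R := (m.+2)`!%:R; have C0 : 0 < C by rewrite ltr0n fact_gt0.
  apply/cvgrPdist_lt => e e0; near=> h.
  have h0 : h != 0 by near: h; exact: nbhs_dnbhs_neq.
  have hC : `|h| < e / C.
    near: h; apply: dnbhs0_lt; exact: divr_gt0.
  rewrite (flat_le0 _ (lexx 0)) subr0 sub0r normrN addr0 [h *: 1]mulr1.
  rewrite normrM normfV.
  rewrite (ger0_norm (flat_ge0 _ _)) ltr_pdivrMl ?normr_gt0//.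
  apply: le_lt_trans (flat_bound m h) _.
  rewrite -real_normK ?num_real// expr2 mulrC -mulrA ltr_pM2l ?normr_gt0//.
  by rewrite -ltr_pdivlMr.
Unshelve. all: by end_near. Qed.

(** The induction on [k] lets [m] vary, since one derivative of [flat m] brings in [flat m.+1] and
    [flat m.+2]. *)
Lemma Ck_flat {n} k m (U : set 'rV[R]_n) f : open U -> Ck k U f ->
  Ck k U (fun x => flat m (f x)).
Proof.
move=> oU; elim: k m => [|k IH] m.
  move=> cf x Ux; apply: continuous_comp; first exact: cf.
  apply: differentiable_continuous; apply/derivable1_diffP.
  by case: (is_derive_flat m (f x)).
move=> Cf; have [df Cf'] := Cf.
have dfl t : differentiable (flat m) t.
  by apply/derivable1_diffP; case: (is_derive_flat m t).
split=> [x Ux|v]; first by apply: differentiable_comp => //; exact: df.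
have C1 := CkM oU (Ck_cst k U (m%:R : R)) (IH m.+1 (CkS Cf)).
have := CkM oU (CkB oU (IH m.+2 (CkS Cf)) C1) (Cf' v).
apply: (Ck_ext oU) => x Ux; apply: esym.
apply: etrans (congr1 (@^~ v) (diff_comp (df x Ux) (dfl (f x)))) _ => /=.
rewrite deriv1E ?derive1E; last exact/derivable1_diffP.
by have [_ ->] := is_derive_flat m (f x); rewrite /GRing.scale /= mulrC.
Qed.

(** The usual smooth transition from 0 (for t <= 0) to 1 (for t >= 1); the denominator never
    vanishes because t and 1 - t are not both nonpositive. *)
Definition step t : R := flat 0 t / (flat 0 t + flat 0 (1 - t)).

Lemma step_den t : 0 < flat 0 t + flat 0 (1 - t).
Proof.
have [t0|t0] := leP t 0.
  by rewrite ltr_wpDl ?flat_ge0// flat_gt0// subr_gt0 (le_lt_trans t0).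
by rewrite ltr_wpDr ?flat_ge0// flat_gt0.
Qed.

Lemma step_ge0 t : 0 <= step t.
Proof. by rewrite divr_ge0 ?flat_ge0// ltW// step_den. Qed.

Lemma step_le1 t : step t <= 1.
Proof. by rewrite ler_pdivrMr ?step_den// mul1r lerDl flat_ge0. Qed.

Lemma step_le0 t : t <= 0 -> step t = 0.
Proof. by move=> t0; rewrite /step flat_le0 ?mul0r. Qed.

Lemma step_ge1 t : 1 <= t -> step t = 1.
Proof.
move=> t1; rewrite /step (@flat_le0 _ (1 - t)) ?subr_le0// addr0 divff//.
by rewrite gt_eqF// flat_gt0// (lt_le_trans _ t1).
Qed.

Lemma Ck_step {n} k (U : set 'rV[R]_n) f : open U -> Ck k U f ->
  Ck k U (fun x => step (f x)).
Proof.
move=> oU Cf; have C1 := Ck_flat 0 oU Cf.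
have C2 := Ck_flat 0 oU (CkB oU (Ck_cst k U (1 : R)) Cf).
apply: (CkM oU C1 (CkV oU _ (CkD oU C1 C2))) => x _.
by rewrite gt_eqF// step_den.
Qed.

(* A product over the coordinates, since the balls of the sup norm are cubes. *)
Definition bump {n} (a : 'rV[R]_n) r (x : 'rV[R]_n) : R :=
  \prod_i step ((4 - ((x 0 i - a 0 i) / r) ^+ 2) / 3).

Lemma Ck_bump {n} k (U : set 'rV[R]_n) a r : open U -> Ck k U (bump a r).
Proof.
move=> oU; apply: Ck_prod => // i; apply: Ck_step => //.
have Cx : Ck k U (fun x : 'rV[R]_n => x 0 i).
  exact: Ck_coord (Ck_id _ _).
have C1 := CkM oU (CkB oU Cx (Ck_cst k U (a 0 i))) (Ck_cst k U r^-1).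
have C4 := CkB oU (Ck_cst k U (4 : R)) (CkM oU C1 C1).
by apply: (Ck_ext oU _ (CkM oU C4 (Ck_cst k U (3^-1 : R)))) => x _.
Qed.

Lemma bump_ge0 {n} (a : 'rV[R]_n) r x : 0 <= bump a r x.
Proof. by apply: prodr_ge0 => i _; exact: step_ge0. Qed.

Lemma bump_le1 {n} (a : 'rV[R]_n) r x : bump a r x <= 1.
Proof. by apply: prodr_ile1 => i _; rewrite step_ge0 step_le1. Qed.

(** The constants in [bump] come from here and from [bump0]: (4 - u^2) / 3 is at least 1 when |u| <=
    1 and at most 0 when |u| >= 2. The square keeps the argument smooth at u = 0. *)
Lemma bump1 {n} (a : 'rV[R]_n) r x : 0 < r -> `|x - a| <= r -> bump a r x = 1.
Proof.
move=> r0 xr; apply: big1 => i _; apply: step_ge1.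
rewrite ler_pdivlMr// mul1r lerBrDl -lerBrDr (_ : 4 - 3 = 1); last by ring.
rewrite -real_normK ?num_real// exprn_ile1// normf_div (gtr0_norm r0).
rewrite ler_pdivrMr// mul1r; apply: le_trans xr.
by have := rV_norm_coord (x - a) i; rewrite !mxE.
Qed.

Lemma bump0 {n} (a : 'rV[R]_n) r x : 0 < r -> 2 * r <= `|x - a| ->
  bump a r x = 0.
Proof.
move=> r0 xr.
have [i xi] : exists i, 2 * r <= `|x 0 i - a 0 i|.
  have [|i] := @rV_norm_attained _ (x - a) (2 * r) _ xr.
    by rewrite mulr_gt0.
  by rewrite !mxE; exists i.
rewrite /bump (bigD1 i)//= step_le0 ?mul0r// pmulr_lle0// subr_le0.
rewrite -real_normK ?num_real// normf_div (gtr0_norm r0).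
rewrite (_ : 4 = 2 ^+ 2); last by ring.
apply: lerXn2r; rewrite ?nnegrE ?ler_pdivlMr//.
by rewrite mul0r.
Qed.

End FlatFunction.

(** * Hadamard's lemma *)

Section UnitIntegral.
Context {R : realType}.
Implicit Types (G : R -> R) (t : R).

(** Continuity is meant in the real line, also at the endpoints 0 and 1. The integrands
    [F (seg a x t)] have it because the segment lies in an open ball on which [F] is continuous. *)
Definition cont01 G := forall t, 0 <= t <= 1 -> {for t, continuous G}.
Definition int01 G : R :=
  \int[@lebesgue_measure R]_(t in `[0, 1]) G t.

Lemma cont01_integrable G : cont01 G ->
  (@lebesgue_measure R).-integrable `[0, 1] (EFin \o G).
Proof.
move=> cG; apply: continuous_compact_integrable; first exact: segment_compact.
apply: continuous_in_subspaceT => t; rewrite inE /= in_itv /=.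
exact: cG.
Qed.

Lemma eq_int01 G H : (forall t, 0 <= t <= 1 -> G t = H t) -> int01 G = int01 H.
Proof.
by move=> GH; apply: eq_Rintegral => t; rewrite inE /= in_itv /=; exact: GH.
Qed.

Lemma cont01B G H : cont01 G -> cont01 H -> cont01 (fun t => G t - H t).
Proof.
by move=> cG cH t t01; apply: continuousB; [exact: cG|exact: cH].
Qed.

Lemma int01_linear k G H : cont01 G -> cont01 H ->
  int01 (fun t => k * G t + H t) = k * int01 G + int01 H.
Proof.
move=> cG cH; have iG := cont01_integrable cG; have iH := cont01_integrable cH.
rewrite /int01 RintegralD//; last first.
  have ckG : cont01 (fun t => k * G t).
    by move=> t t01; apply: continuousM; [exact: cst_continuous|exact: cG].
  exact: cont01_integrable ckG.
by rewrite RintegralZl.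
Qed.

Lemma int01B G H : cont01 G -> cont01 H ->
  int01 (fun t => G t - H t) = int01 G - int01 H.
Proof.
move=> cG cH; rewrite addrC -mulN1r -int01_linear//.
by apply: eq_int01 => t _; rewrite mulN1r addrC.
Qed.

Lemma int01_cst k : int01 (cst k) = k.
Proof.
rewrite /int01 Rintegral_cst//= lebesgue_measure_itv/= lte_fin ltr01.
by rewrite oppr0 adde0 /= mulr1.
Qed.

Lemma int01_norm_le G k : cont01 G -> (forall t, 0 <= t <= 1 -> `|G t| <= k) ->
  `|int01 G| <= k.
Proof.
move=> cG Gk; have iG := cont01_integrable cG.
have c0 : cont01 (cst k) by move=> t _; exact: cst_continuous.
rewrite -[leRHS]int01_cst; apply: le_trans (le_normr_Rintegral _ iG) _ => //.
apply: le_Rintegral => //.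
- apply: (@cont01_integrable (fun t => `|G t|)) => t t01.
  by apply: continuous_comp (cG _ t01) _; exact: norm_continuous.
- exact: cont01_integrable c0.
Qed.

Lemma int01_ftc (F G : R -> R) :
  (forall t, 0 <= t <= 1 -> is_derive t 1 F (G t)) -> cont01 G ->
  int01 G = F 1 - F 0.
Proof.
move=> dF cG.
have cF t : 0 <= t <= 1 -> {for t, continuous F}.
  move=> /dF[df _]; apply: differentiable_continuous; exact/derivable1_diffP.
have := @continuous_FTC2 R G F 0 1 ltr01.
rewrite /int01 /Rintegral => -> //.
- by apply: continuous_in_subspaceT => t; rewrite inE /= in_itv /=; exact: cG.
- split=> [t||].
  + by rewrite in_itv /= => /andP[t0 t1]; case: (dF t); rewrite ?ltW.
  + by apply: cvg_at_right_filter; apply: cF; rewrite lexx ler01.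
  + by apply: cvg_at_left_filter; apply: cF; rewrite lexx ler01.
- move=> t; rewrite in_itv /= => /andP[t0 t1]; rewrite derive1E.
  by case: (dF t); rewrite ?ltW.
Qed.

End UnitIntegral.

Lemma diff_of_bound {R : realType} {V W : normedModType R} (F : V -> W) x
    (L : {linear V -> W}) : continuous L ->
  (forall e, 0 < e -> exists2 d, 0 < d &
     forall v, `|v| < d -> `|F (x + v) - F x - L v| <= e * `|v|) ->
  differentiable F x /\ 'd F x = L :> (_ -> _).
Proof.
move=> cL H.
have E : F \o shift x = cst (F x) + L +o_ 0 id.
  apply/eqaddoP => e e0; have [d d0 Hd] := H _ e0.
  near=> v; rewrite !fctE /= opprD addrA [v + x]addrC; apply: Hd.
  by near: v; exact: nbhs0_lt.
have dE := diff_unique cL E.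
by split=> //; apply/diff_locallyP; rewrite dE; split.
Unshelve. all: by end_near. Qed.

Section Hadamard.
Context {R : realType} {n : nat}.
Implicit Types (r e s t : R) (a x v : 'rV[R]_n) (F : 'rV[R]_n -> R).

Lemma linear_rV_continuous (L : {linear 'rV[R]_n -> R}) : continuous L.
Proof.
have -> : (L : _ -> _) = (fun v => \sum_i v 0 i * L (delta_mx 0 i)).
  apply/funext => v; rewrite {1}(row_sum_delta v) linear_sum.
  by apply: eq_bigr => i _; rewrite linearZ.
have C : Ck 0 [set: 'rV[R]_n] (fun v => \sum_i v 0 i * L (delta_mx 0 i)).
  apply: Ck_big => [|i]; first exact: openT.
  apply: (CkM openT _ (Ck_cst _ _ _)).
  exact: (Ck_coord _ openT (Ck_id _ _)).
by move=> v; exact: C.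
Qed.

Lemma is_derive_line F z w s : differentiable F (z + s *: w) ->
  is_derive s 1 (fun t => F (z + t *: w)) ('d F (z + s *: w) w).
Proof.
move=> dF; set g := fun t => z + t *: w.
have [dg gE] : is_diff s g (0 + *:%R^~ w) :=
  is_diffD (is_diff_cst z (s : R^o)) (is_diff_scalel s w).
have dFg : differentiable F (g s) by [].
have dc : differentiable (F \o g) s by exact: differentiable_comp.
apply: DeriveDef; first by apply/derivable1_diffP.
rewrite -derive1E derive1E'// (diff_comp dg dFg) /= gE.
by rewrite fctE /= add0r scale1r.
Qed.

Definition seg a x t := a + t *: (x - a).
Definition nball a r := [set x | `|x - a| < r].

Lemma nball_ball a r : nball a r = ball a r.
Proof. by apply/seteqP; split=> x; rewrite -ball_normE /= distrC. Qed.

Lemma nball_open a r : open (nball a r).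
Proof. by rewrite nball_ball; exact: ball_open. Qed.

Lemma seg_nball a r x t : 0 <= t <= 1 -> nball a r x -> nball a r (seg a x t).
Proof.
move=> /andP[t0 t1].
rewrite /nball /seg /= addrAC subrr add0r normrZ (ger0_norm t0).
by apply: le_lt_trans; rewrite ler_piMl.
Qed.

Lemma seg_cont a x t : {for t, continuous (seg a x)}.
Proof.
apply: continuousD; first exact: cst_continuous.
exact: scalel_continuous.
Qed.

(* Uniformity in t comes from the compactness of [0, 1]. *)
Lemma seg_uniform a r F x e : Ck 0 (nball a r) F -> nball a r x -> 0 < e ->
  exists2 d, 0 < d & forall v t, `|v| < d -> 0 <= t <= 1 ->
    nball a r (seg a x t + v) /\ `|F (seg a x t + v) - F (seg a x t)| < e.
Proof.
move=> cF Bx e0.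
have /compact_near_coveringP cK := @segment_compact R 0 1.
pose P v (t : R) := nball a r (seg a x t + v) /\
              `|F (seg a x t + v) - F (seg a x t)| < e.
have : \forall v \near (0 : 'rV[R]_n), `[0, 1] `<=` P v.
  have cK' := cK _ (nbhs (0 : 'rV[R]_n)) P _.
  apply: cK' => t0; rewrite /= in_itv /= => t01.
  set z := seg a x t0; have Bz : nball a r z by exact: seg_nball.
  have nF : \forall z' \near z, nball a r z' /\ `|F z' - F z| < e / 2.
    near=> z'; split.
      by near: z'; apply: open_nbhs_nbhs; split => //; exact: nball_open.
    rewrite distrC; near: z'.
    by have /cvgrPdist_lt := cF _ Bz; apply; exact: divr_gt0.
  have : \forall p \near (t0 : R, 0 : 'rV[R]_n), 
     nball a r (seg a x p.1 + p.2) /\ `|F (seg a x p.1 + p.2) - F z| < e / 2.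
    have cs : (fun p : R * 'rV[R]_n => seg a x p.1 + p.2) p
        @[p --> (t0 : R, 0 : 'rV[R]_n)] --> seg a x t0 + 0.
      apply: cvgD; last exact: cvg_snd.
      apply: (@cvg_comp _ _ _ fst (seg a x)); first exact: cvg_fst.
      exact: seg_cont.
    rewrite addr0 in cs; exact: cs _ nF.
  have : \forall p \near (t0 : R, 0 : 'rV[R]_n),
      `|F (seg a x p.1) - F z| < e / 2.
    have cs : (fun p : R * 'rV[R]_n => seg a x p.1) p
        @[p --> (t0 : R, 0 : 'rV[R]_n)] --> seg a x t0.
      apply: (@cvg_comp _ _ _ fst (seg a x)); first exact: cvg_fst.
      exact: seg_cont.
    have nF2 : \forall z' \near z, `|F z' - F z| < e / 2.
      by apply: filterS nF => ? [].
    exact: cs _ nF2.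
  apply: filterS2 => -[t v] /= H1 [H2 H3]; split => //.
  rewrite (_ : _ - _ = (F (seg a x t + v) - F z) - (F (seg a x t) - F z)).
    by apply: le_lt_trans (ler_normB _ _) _; rewrite (splitr e) ltrD.
  by rewrite opprB addrA subrK.
move=> /nbhs_normP[d /= d0 H]; exists d => // v t vd t01.
by apply: H => /=; rewrite ?sub0r ?normrN// in_itv.
Unshelve. all: by end_near. Qed.

End Hadamard.

Section HadamardLemma.
Context {R : realType} {n : nat} (a : 'rV[R]_n) (r : R).
Implicit Types (x v : 'rV[R]_n) (F : 'rV[R]_n -> R) (s t e : R).
Local Notation B := (nball a r).
Local Notation sg := (seg a).

(** The weight t^m is there because each differentiation in [x] under the integral sign produces a
    factor t: the derivative of [avg m F] is the average of weight [m.+1] of the derivative of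
    [F]. *)
Definition avg m F x : R := int01 (fun t => t ^+ m * F (sg x t)).

Lemma cont_avg m F x : Ck 0 B F -> B x -> cont01 (fun t => t ^+ m * F (sg x t)).
Proof.
move=> cF Bx t t01; apply: continuousM; first exact: exprn_continuous.
by apply: continuous_comp; [exact: seg_cont|exact/cF/seg_nball].
Qed.

Lemma segD x v t : sg (x + v) t = sg x t + t *: v.
Proof. by rewrite /seg addrAC scalerDr addrA. Qed.

Lemma expr01 m t : 0 <= t <= 1 -> 0 <= t ^+ m <= 1.
Proof. by move=> /andP[t0 t1]; rewrite exprn_ge0// exprn_ile1. Qed.

Lemma avg_cont m F : Ck 0 B F -> Ck 0 B (avg m F).
Proof.
move=> cF x Bx; apply/(@cvgrPdist_le _ _ _ (nbhs x) (nbhs_filter x)) => e e0.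
have [d d0 H] := seg_uniform cF Bx e0.
have nB : \forall y \near x, B y.
  by apply: open_nbhs_nbhs; split => //; exact: nball_open.
have nd : \forall y \near x, `|y - x| < d.
  by apply/nbhs_normP; exists d => //= y; rewrite distrC.
apply: filterS2 nB nd => y By yd.
have cx := cont_avg (m := m) cF Bx; have cy := cont_avg (m := m) cF By.
rewrite /avg -(int01B cx cy); apply: int01_norm_le => [|t t01].
  exact: (cont01B cx cy).
have /andP[tm0 tm1] := expr01 m t01; have /andP[t0 t1] := t01.
rewrite -mulrBr normrM (ger0_norm tm0) -[leRHS]mul1r.
apply: ler_pM => //; rewrite distrC.
have -> : sg y t = sg x t + t *: (y - x) by rewrite -segD addrC subrK.
apply: ltW; apply: (H _ _ _ t01).2.
by rewrite normrZ ger0_norm// (le_lt_trans _ yd)// ler_piMl.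
Qed.

(** Bundles the candidate differential as a linear map, which is the form required by
    [diff_of_bound]. *)
Lemma avg_dir_linear m F x : (forall v, Ck 0 B (fun y => 'd F y v)) -> B x ->
  exists L : {linear 'rV[R]_n -> R},
    forall v, L v = avg m (fun y => 'd F y v) x.
Proof.
move=> CF' Bx.
have lin k u v : avg m (fun y => 'd F y (k *: u + v)) x =
    k * avg m (fun y => 'd F y u) x + avg m (fun y => 'd F y v) x.
  rewrite -int01_linear; [|exact: cont_avg (CF' _) Bx..].
  by apply: eq_int01 => t _; rewrite linearP /= mulrDr mulrCA.
pose LM := GRing.isLinear.Build R 'rV[R]_n R *%R
  (fun v => avg m (fun y => 'd F y v) x) lin.
pose L : {linear 'rV[R]_n -> R} :=
  HB.pack (fun v => avg m (fun y => 'd F y v) x) LM.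
by exists L.
Qed.

(** Differentiation under the integral sign. For fixed t, the mean value theorem turns the increment
    of [F] along t v into the differential of [F] at an intermediate point; the uniform continuity
    of the partial derivatives along the segment compares it, uniformly in t, with the differential
    on the segment. *)
Lemma avg_diff m F x : Ck 1 B F -> B x ->
  differentiable (avg m F) x /\
  forall v, 'd (avg m F) x v = avg m.+1 (fun y => 'd F y v) x.
Proof.
move=> CF Bx; have [dF CF'] := CF; have C0 := CkS CF.
have [L LE] := avg_dir_linear m.+1 CF' Bx.
suff [dA dE] : differentiable (avg m F) x /\ 'd (avg m F) x = L :> (_ -> _).
  by split=> [|v]; [exact: dA|rewrite -LE; exact: (congr1 (@^~ v) dE)].
apply: diff_of_bound => [|e e0]; first exact: linear_rV_continuous.
(* Each of the [n] coordinates contributes at most |v| e / (n + 1) to the error; dividing by n + 1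
   also makes sense when [n] is 0. *)
have en0 : 0 < e / n.+1%:R by rewrite divr_gt0.
pose D i (d : R) := 0 < d /\ forall v t, `|v| < d -> 0 <= t <= 1 ->
  B (sg x t + v) /\
  `|'d F (sg x t + v) (delta_mx 0 i) - 'd F (sg x t) (delta_mx 0 i)|
      < e / n.+1%:R.
have [d [d0 Bd Hd]] : exists d, [/\ 0 < d,
    forall v t, `|v| < d -> 0 <= t <= 1 -> B (sg x t + v) &
    forall i, D i d].
  have [d0 d00 H0] := seg_uniform C0 Bx ltr01.
  have /choice[d Hd] i : exists d, D i d.
    by have [d d0' H] := seg_uniform (CF' (delta_mx 0 i)) Bx en0; exists d.
  (* [d0] keeps the displaced segment inside the ball, and is the value of the minimum when there is
     no coordinate. *)
  pose dm := \big[Num.min/d0]_i d i.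
  have dmi i : dm <= d i by exact: bigmin_le.
  exists dm; split.
  - by apply/bigmin_gtP; split=> // i _; case: (Hd i).
  - move=> v t vd t01; apply: (H0 _ _ _ t01).1; apply: lt_le_trans vd _.
    exact: bigmin_le_id.
  - move=> i; split; first by apply/bigmin_gtP; split=> // j _; case: (Hd j).
    by move=> v t vd t01; apply: (Hd i).2 => //; exact: lt_le_trans (dmi i).
exists d => // v vd.
have Bxv : B (x + v).
  have := Bd v 1 vd; rewrite /seg scale1r subrKC; apply.
  by rewrite ler01 lexx.
have cx := cont_avg (m := m) C0 Bx; have cy := cont_avg (m := m) C0 Bxv.
have cd := cont_avg (m := m.+1) (CF' v) Bx.
rewrite LE /avg -(int01B cy cx) -(int01B (cont01B cy cx) cd).
apply: int01_norm_le => [|t t01]; first exact: (cont01B (cont01B cy cx) cd).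
have /andP[tm0 tm1] := expr01 m t01; have /andP[t0 t1] := t01.
rewrite exprSr -mulrA -!mulrBr normrM (ger0_norm tm0) -[leRHS]mul1r ler_pM//.
rewrite segD; set z := sg x t.
have sd s : 0 <= s <= 1 -> `|s *: (t *: v)| < d.
  move=> /andP[s0 s1]; rewrite scalerA normrZ ger0_norm ?mulr_ge0//.
  by rewrite (le_lt_trans _ vd)// ler_piMl// mulr_ile1.
have dline s : 0 <= s <= 1 -> is_derive s 1 (fun s => F (z + s *: (t *: v)))
    ('d F (z + s *: (t *: v)) (t *: v)).
  by move=> s01; apply/is_derive_line/dF/Bd => //; exact: sd.
have [s s01] : exists2 s, 0 <= s <= 1 & F (z + t *: v) - F z =
    'd F (z + s *: (t *: v)) (t *: v).
  have [||s] := @MVT_segment R (fun s => F (z + s *: (t *: v)))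
      (fun s => 'd F (z + s *: (t *: v)) (t *: v)) 0 1 ler01.
  - by move=> s; rewrite in_itv /= => /andP[s0 s1]; apply: dline; rewrite !ltW.
  - apply: continuous_in_subspaceT => s; rewrite inE /= in_itv /= => s01.
    apply: differentiable_continuous; apply/derivable1_diffP.
    by have [] := dline s s01.
  - rewrite in_itv /= => s01.
    rewrite scale1r scale0r addr0 subr0 mulr1 => E.
    by exists s.
move=> ->.
rewrite -[t * _]linearZ /= [X in X - _]diff_coordE [X in _ - X]diff_coordE.
rewrite -sumrB; apply: le_trans (ler_norm_sum _ _ _) _.
have H i : `|(t *: v) 0 i *: 'd F (z + s *: (t *: v)) (delta_mx 0 i) -
    (t *: v) 0 i *: 'd F z (delta_mx 0 i)| <= `|v| * (e / n.+1%:R).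
  rewrite -scalerBr normrZ ler_pM//.
    rewrite mxE normrM (ger0_norm t0); apply: le_trans (rV_norm_coord v i).
    by rewrite ler_piMl.
  by have [_ Hi] := Hd i; have [_ /ltW] := Hi _ t (sd s s01) t01.
apply: le_trans (ler_sum _ (fun i _ => H i)) _.
rewrite sumr_const card_ord -[leLHS]mulr_natr [leRHS]mulrC -mulrA ler_wpM2l//.
by rewrite mulrAC ler_pdivrMr// ler_wpM2l ?ler_nat// ltW.
Qed.

Lemma Ck_avg k m F : Ck k B F -> Ck k B (avg m F).
Proof.
elim: k m F => [|k IH] m F CF; first exact: avg_cont.
have [dF CF'] := CF.
have C1 : Ck 1 B F by split=> [|v]; [exact: dF|exact: Ck0 (CF' v)].
split=> [x Bx|v]; first by have [] := avg_diff m C1 Bx.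
apply: (Ck_ext (@nball_open _ _ a r) _ (IH m.+1 _ (CF' v))) => x Bx.
by have [_ dE] := avg_diff m C1 Bx; exact/esym/dE.
Qed.

(** The fundamental theorem of calculus along the segment from [a] to [x], with the differential in
    the direction x - a split over the coordinates. *)
Lemma hadamard F x : smooth_on B F -> B x ->
  F x = F a + \sum_i (x 0 i - a 0 i) * avg 0 (fun y => 'd F y (delta_mx 0 i)) x.
Proof.
move=> SF Bx; have [dF CF] := SF 1.
have Bs t : 0 <= t <= 1 -> B (sg x t) by move=> t01; exact: seg_nball.
have [L LE] := avg_dir_linear 0 CF Bx.
apply/eqP; rewrite addrC -subr_eq; apply/eqP.
transitivity (L (x - a)); last first.
  rewrite {1}(row_sum_delta (x - a)) linear_sum; apply: eq_bigr => i _.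
  by rewrite linearZ /= LE !mxE.
rewrite LE /avg; apply: esym.
have := @int01_ftc _ (fun t => F (a + t *: (x - a)))
  (fun t => t ^+ 0 * 'd F (sg x t) (x - a)).
rewrite scale1r scale0r addr0 subrKC; apply; last exact: cont_avg (CF _) Bx.
by move=> t t01; rewrite expr0 mul1r; apply/is_derive_line/dF/Bs.
Qed.

Lemma avg_center F : avg 0 F a = F a.
Proof.
rewrite -[RHS]int01_cst; apply: eq_int01 => t _.
by rewrite mul1r /seg subrr scaler0 addr0.
Qed.

End HadamardLemma.

(** * Smooth functions and frames on a manifold *)

Section Charts.
Context {R : realType} {n : nat} (M : manifold R n).
Implicit Types (c d : chart R n M) (p q : M) (a x : 'rV[R]_n) (r : R).

(** The charts of the oriented atlas need not belong to [atlas], so the constructions in a chart are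
    made for every chart compatible with the smooth structure. *)
Definition compatible c :=
  forall d, atlas d -> smooth_transition c d /\ smooth_transition d c.

Lemma atlas_compatible c : atlas c -> compatible c.
Proof.
by move=> Ac d Ad; have [_ S] := @atlas_smooth _ _ M; split; exact: S.
Qed.

Lemma param_open c (V : set M) : open V -> open (cod c `&` param c @^-1` V).
Proof.
move=> oV; rewrite openE => x [cx Vx]; apply: filterI.
  exact: open_nbhs_nbhs (conj (cod_open c) cx).
exact: (param_cont cx (open_nbhs_nbhs (conj oV Vx))).
Qed.

Lemma coord_open c (U : set 'rV[R]_n) :
  open U -> open (dom c `&` coord c @^-1` U).
Proof.
move=> oU; rewrite openE => p [cp Up]; apply: filterI.
  exact: open_nbhs_nbhs (conj (dom_open c) cp).
exact: (coord_cont cp (open_nbhs_nbhs (conj oU Up))).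
Qed.

Lemma smooth_local (F : M -> R) :
  (forall p, exists V, [/\ open V, V p & forall c, atlas c ->
    smooth_on (cod c `&` param c @^-1` V) (F \o param c)]) ->
  F \in @smooth _ _ M.
Proof.
move=> H; apply/asboolP => c Ac k; apply: Ck_local => x cx.
have [V [oV Vp S]] := H (param c x); exists (cod c `&` param c @^-1` V).
by split=> //; [exact: param_open|exact: S].
Qed.

Lemma smooth_glue (F : M -> R) :
  (forall p, exists V, [/\ open V, V p & exists s : smoothFun M,
    forall q, V q -> F q = s q]) -> F \in @smooth _ _ M.
Proof.
move=> H; apply: smooth_local => p; have [V [oV Vp [s Fs]]] := H p.
exists V; split=> // c Ac k.
have /asboolP/(_ c Ac k) := smooth_funP s.
move=> /(Ck_sub (@subIsetl _ _ (param c @^-1` V))).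
by apply: Ck_ext => [|x [_ Vx]]; [exact: param_open|exact/esym/Fs].
Qed.

Lemma smooth_compatible (f : smoothFun M) c :
  compatible c -> smooth_on (cod c) (f \o param c).
Proof.
move=> Cc k; apply: Ck_local => x cx.
have [d Ad dp] := (@atlas_smooth _ _ M).1 (param c x).
have oV := param_open (c := c) (dom_open d).
exists (cod c `&` param c @^-1` dom d).
split=> //.
have /asboolP/(_ d Ad k) Sf := smooth_funP f.
have [/(_ k) T _] := Cc d Ad.
apply: (@Ck_ext _ _ _ k _ ((f \o param d) \o transition c d)) => //.
  move=> y [cy dy].
  by rewrite /= coordK.
have gV y : (cod c `&` param c @^-1` dom d) y -> cod d (transition c d y).
  by move=> [cy dy]; exact: coord_cod.
exact: Ck_comp oV gV T Sf.
Qed.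

Definition extend0 c (K : set 'rV[R]_n) (u : 'rV[R]_n -> R) (q : M) : R :=
  if `[< dom c q /\ K (coord c q) >] then u (coord c q) else 0.

Lemma extend0_smooth c (K U : set 'rV[R]_n) (u : 'rV[R]_n -> R) :
  compatible c -> compact K -> open U -> K `<=` U -> U `<=` cod c ->
  smooth_on U u -> (forall x, U x -> ~ K x -> u x = 0) ->
  extend0 c K u \in @smooth _ _ M.
Proof.
move=> Cc kK oU KU Uc Su u0; apply/asboolP => d Ad k; apply: Ck_local => x dx.
set q := param d x; have [_ T] := Cc d Ad.
have [[cq Uq]|nU] := pselect (dom c q /\ U (coord c q)).
  set V := cod d `&` param d @^-1` (dom c `&` coord c @^-1` U).
  have oV : open V by exact/param_open/coord_open.
  exists V; split=> //.
  apply: (@Ck_ext _ _ _ k _ (u \o transition d c)) => // [y [dy [cy Uy]]|].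
    rewrite /= /extend0; case: asboolP => // H; apply: u0 => // Ky.
    by apply: H.
  apply: (Ck_comp oV _ _ (Su k)) => [y [_ []]//|].
  by apply: (Ck_sub _ (T k)) => y [? []].
have kK' : compact (param c @` K).
  apply: continuous_compact => //; apply: continuous_in_subspaceT => y.
  by rewrite inE => /KU/Uc/param_cont.
have cK' := compact_closed (@manifold_hausdorff _ _ M) kK'.
set V := cod d `&` param d @^-1` (~` (param c @` K)).
have oV : open V by apply: param_open; exact: closed_openC.
exists V; split=> //.
  split=> // -[y Ky E]; apply: nU; rewrite -/q in E; rewrite -E.
  by rewrite paramK; [split; [exact/param_dom/Uc/KU|exact: KU]|exact/Uc/KU].
apply: (@Ck_ext _ _ _ k _ (cst 0)) => // [y [dy Ky]|]; last exact: Ck_cst.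
rewrite /= /extend0; case: asboolP => // -[cy Kc]; case: Ky.
by exists (coord c (param d y)); rewrite ?coordK.
Qed.

End Charts.

Section Cutoff.
Context {R : realType} {n : nat} (M : manifold R n).
Implicit Types (c d : chart R n M) (p q : M) (a x : 'rV[R]_n) (r : R).

Definition cball a r := [set x : 'rV[R]_n | `|x - a| <= r].

Lemma cball_compact a r : compact (cball a r).
Proof.
apply: bounded_closed_compact.
  exists (`|a| + r); split=> [|y ry x xr]; first exact: num_real.
  rewrite /= -(subrK a x) (le_trans (ler_normD _ _))// addrC.
  by rewrite (le_trans _ (ltW ry))// lerD2l.
rewrite (_ : cball a r = (fun x => `|x - a|) @^-1` [set y | y <= r]) //.
apply: closed_comp => [x _|]; last exact: closed_le.
apply: (@continuous_comp _ _ _ (fun x => x - a) Num.norm).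
  by apply: continuousB; [exact: cvg_id|exact: cst_continuous].
exact: norm_continuous.
Qed.

(** The radius 3 r leaves room for a bump that is 1 on the ball of radius r and vanishes beyond 2 r:
    the closed ball of radius 2 r is a compact subset of the open one of radius 3 r. *)
Lemma nball_sub (U : set 'rV[R]_n) a : open U -> U a ->
  exists2 r, 0 < r & nball a (3 * r) `<=` U.
Proof.
move=> oU Ua; have /nbhs_normP[e /= e0 H] := open_nbhs_nbhs (conj oU Ua).
exists (e / 3) => [|x xr]; first by rewrite divr_gt0.
by apply: H; rewrite /= distrC; move: xr; rewrite /nball /= mulrC divfK.
Qed.

Definition cutoff c a r (h : 'rV[R]_n -> R) :=
  extend0 c (cball a (2 * r)) (fun x => bump a r x * h x).

Lemma cutoff_smooth c a r h : compatible c -> 0 < r ->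
  nball a (3 * r) `<=` cod c -> smooth_on (nball a (3 * r)) h ->
  cutoff c a r h \in @smooth _ _ M.
Proof.
move=> Cc r0 Bc Sh; apply: (extend0_smooth Cc _ _ _ Bc).
- exact: cball_compact.
- exact: nball_open.
- move=> x; rewrite /cball /nball /= => /le_lt_trans; apply.
  by rewrite ltr_pM2r// ltr_nat.
- move=> k; apply: CkM (Sh k); first exact: nball_open.
  exact/Ck_bump/nball_open.
- by move=> x _ /negP; rewrite -ltNge => /ltW H; rewrite bump0 ?mul0r.
Qed.

Lemma cutoffE c a r h q : 0 < r -> dom c q ->
  cutoff c a r h q = bump a r (coord c q) * h (coord c q).
Proof.
move=> r0 cq; rewrite /cutoff /extend0; case: asboolP => // H.
rewrite bump0 ?mul0r// ltW// ltNge; apply/negP => H'; exact: H.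
Qed.

Lemma cutoff1 c a r h q : 0 < r -> dom c q -> `|coord c q - a| <= r ->
  cutoff c a r h q = h (coord c q).
Proof. by move=> r0 cq qr; rewrite cutoffE// bump1// mul1r. Qed.

Lemma cutoff0 c a r h q : ~ (dom c q /\ `|coord c q - a| <= 2 * r) ->
  cutoff c a r h q = 0.
Proof. by rewrite /cutoff /extend0; case: asboolP. Qed.

End Cutoff.

Section Evaluation.
Context {R : realType} {n : nat} (M : manifold R n).
Local Notation C := (smoothFun M).
Implicit Types (f g : C) (p q : M) (X Y Z : vectorField M).

Lemma evD f g q : (f + g) q = f q + g q. Proof. by []. Qed.
Lemma evN f q : (- f) q = - f q. Proof. by []. Qed.
Lemma evM f g q : (f * g) q = f q * g q. Proof. by []. Qed.
Lemma evZ (k : R) f q : (k *: f) q = k * f q. Proof. by []. Qed.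
Lemma ev0 q : (0 : C) q = 0. Proof. by []. Qed.
Lemma ev1 q : (1 : C) q = 1. Proof. by []. Qed.
Definition evE := (evD, evN, evM, evZ, ev0, ev1).

Lemma ev_sum (I : Type) (s : seq I) (P : pred I) (F : I -> C) q :
  (\sum_(i <- s | P i) F i) q = \sum_(i <- s | P i) F i q.
Proof. exact: (big_morph (fun f : C => f q)). Qed.

Lemma vfD X f g : X (f + g) = X f + X g.
Proof. by have := (derivationP X).1 1 f g; rewrite !scale1r. Qed.

Lemma vfM X f g : X (f * g) = X f * g + f * X g.
Proof. exact: (derivationP X).2. Qed.

Lemma vf0 X : X 0 = 0.
Proof. by apply: (addrI (X 0)); rewrite -vfD !addr0. Qed.

Lemma vfZ X (k : R) f : X (k *: f) = k *: (X f : C).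
Proof. by have := (derivationP X).1 k f 0; rewrite vf0 !addr0. Qed.

Lemma vfN X f : X (- f) = - X f.
Proof. by rewrite -scaleN1r vfZ scaleN1r. Qed.

Lemma vfB X f g : X (f - g) = X f - X g.
Proof. by rewrite vfD vfN. Qed.

Lemma vf1 X : X 1 = 0.
Proof.
have := vfM X 1 1; rewrite !mulr1 mul1r => /eqP.
by rewrite -subr_eq subrr eq_sym => /eqP.
Qed.

Lemma vf_cst X (k : R) : X (k *: (1 : C)) = 0.
Proof. by rewrite vfZ vf1 scaler0. Qed.

Lemma vf_sum X (I : Type) (s : seq I) (P : pred I) (F : I -> C) :
  X (\sum_(i <- s | P i) F i) = \sum_(i <- s | P i) X (F i).
Proof. exact: (big_morph X (vfD X) (vf0 X)). Qed.

Lemma vfP X Y : (forall f q, (X f : C) q = (Y f : C) q) -> X = Y.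
Proof.
by move=> XY; apply/val_inj/funext => f; apply: smoothFunP => q; exact: XY.
Qed.

Lemma vfaddE X Y f : (X + Y) f = X f + Y f. Proof. by []. Qed.
Lemma vfoppE X f : (- X) f = - X f. Proof. by []. Qed.
Lemma vfscaleE g X f : (g *: X) f = g * X f. Proof. by []. Qed.
Lemma vfzeroE f : (0 : vectorField M) f = 0. Proof. by []. Qed.
Definition vfE := (vfaddE, vfoppE, vfscaleE, vfzeroE).

Lemma vfsumE (I : Type) (s : seq I) (P : pred I) (F : I -> vectorField M) f :
  (\sum_(i <- s | P i) F i) f = \sum_(i <- s | P i) F i f.
Proof. exact: (big_morph (fun X : vectorField M => X f)). Qed.

End Evaluation.

Section ChartFrame.
Context {R : realType} {n : nat} (M : manifold R n).
Local Notation C := (smoothFun M).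
Implicit Types (c d : chart R n M) (p q : M) (f : C) (Y : vectorField M).

Lemma smooth_partial c f r a v : compatible c -> nball a r `<=` cod c ->
  smooth_on (nball a r) (fun x => 'd (f \o param c) x v).
Proof.
move=> Cc Bc k; have [_ H] := smooth_compatible f Cc k.+1.
exact: Ck_sub (H v).
Qed.

Lemma diff_param c f x :
  compatible c -> cod c x -> differentiable (f \o param c) x.
Proof. by move=> Cc cx; have [df _] := smooth_compatible f Cc 1; exact: df. Qed.

Section Cut.
Context (c : chart R n M) (a : 'rV[R]_n) (r : R) (Cc : compatible c)
  (r0 : 0 < r) (Bc : nball a (3 * r) `<=` cod c).

Definition cut (h : 'rV[R]_n -> R) (Sh : smooth_on (nball a (3 * r)) h) : C :=
  SmoothFun (cutoff_smooth Cc r0 Bc Sh).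

Lemma cut_neq0 h Sh q : @cut h Sh q != 0 ->
  dom c q /\ nball a (3 * r) (coord c q).
Proof.
move=> /eqP H; apply: contrapT => H'; apply: H; apply: cutoff0 => -[cq qr].
by apply: H'; split => //; apply: le_lt_trans qr _; rewrite ltr_pM2r// ltr_nat.
Qed.

(** The coordinate field of the chart multiplied by a bump and extended by 0, so that it acts on
    global functions; it is the true coordinate field only where the bump is 1. *)
Definition field_fun i f : C^o :=
  cut (smooth_partial f (delta_mx 0 i) Cc Bc).

Lemma field_derivation i : field_fun i \in @derivation _ _ M.
Proof.
have dp f q : dom c q -> differentiable (f \o param c) (coord c q).
  by move=> cq; apply: diff_param => //; exact: coord_cod.
have E f q : dom c q -> (field_fun i f : C) q =
    bump a r (coord c q) * 'd (f \o param c) (coord c q) (delta_mx 0 i).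
  by move=> cq; exact: cutoffE.
have E0 f q : ~ dom c q -> (field_fun i f : C) q = 0.
  by move=> cq; apply: cutoff0 => -[].
apply/asboolP; split=> [k f g|f g]; apply: smoothFunP => q; rewrite !evE.
  have [cq|cq] := pselect (dom c q); last by rewrite !E0// mulr0 addr0.
  rewrite !E// mulrCA -mulrDr; congr (_ * _).
  apply: etrans (congr1 (@^~ (delta_mx 0 i))
    (diffD (differentiableZ k (dp f q cq)) (dp g q cq))) _.
  congr (_ + _); exact: (congr1 (@^~ (delta_mx 0 i)) (diffZ k (dp f q cq))).
have [cq|cq] := pselect (dom c q); last by rewrite !E0// mulr0 mul0r addr0.
have D : 'd ((f * g : C) \o param c) (coord c q) (delta_mx 0 i) =
    (f \o param c) (coord c q) * 'd (g \o param c) (coord c q) (delta_mx 0 i) +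
    (g \o param c) (coord c q) * 'd (f \o param c) (coord c q) (delta_mx 0 i) :=
  congr1 (@^~ (delta_mx 0 i)) (diffM (dp f q cq) (dp g q cq)).
have pE (u : C) : (u \o param c) (coord c q) = u q by rewrite /= coordK.
rewrite !E// D !pE mulrDr addrC; congr (_ + _); last exact: mulrCA.
by rewrite [g q * _]mulrC mulrA.
Qed.

Definition chart_field i := VectorField (field_derivation i).

End Cut.

(* A derivation is determined by its values on the coordinates: by Hadamard's
   lemma f - f q is, near q, a sum of products of functions vanishing at q. *)
Lemma chart_frame c p : compatible c -> dom c p ->
  exists (X : 'I_n -> vectorField M) (y : 'I_n -> C) (V : set M),
  [/\ open V, V p, V `<=` dom c,
      forall q j, V q -> y j q = coord c q 0 j &
      forall q, V q ->
        (forall i f, (X i f : C) q =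
          'd (f \o param c) (coord c q) (delta_mx 0 i)) /\
        (forall Y f, (Y f : C) q = \sum_j (Y (y j) : C) q * (X j f : C) q)].
Proof.
move=> Cc cp; set a := coord c p.
have [r r0 Bc] := nball_sub (cod_open c) (coord_cod cp).
have Sy j : smooth_on (nball a (3 * r)) (fun x => x 0 j).
  by move=> k; exact: (Ck_coord j (@nball_open _ _ _ _) (Ck_id _ _)).
exists (chart_field Cc r0 Bc), (fun j => cut Cc r0 Bc (Sy j)).
exists (dom c `&` coord c @^-1` nball a r).
have Vy q j : (dom c `&` coord c @^-1` nball a r) q ->
    cut Cc r0 Bc (Sy j) q = coord c q 0 j.
  by move=> [cq qr]; apply: cutoff1 => //; exact: ltW.
have VX q i f : (dom c `&` coord c @^-1` nball a r) q ->
    (chart_field Cc r0 Bc i f : C) q =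
      'd (f \o param c) (coord c q) (delta_mx 0 i).
  by move=> [cq qr]; apply: cutoff1 => //; exact: ltW.
split=> //; first exact/coord_open/nball_open.
  by split=> //; rewrite /nball /= subrr normr0.
move=> q Vq; split=> [i f|Y f]; first exact: VX.
have [cq qr] := Vq; set z := coord c q.
have [s s0 zs] := nball_sub (@nball_open _ _ a r) qr.
have ac : nball a r `<=` cod c.
  move=> x xr; apply: (Bc); apply: lt_le_trans xr _.
  by rewrite ler_peMl// ?ltW// ltr1n.
have zc : nball z (3 * s) `<=` cod c by move=> x /zs /ac.
have SF := smooth_compatible f Cc.
pose h j := avg z 0 (fun x => 'd (f \o param c) x (delta_mx 0 j)).
have Sh j : smooth_on (nball z (3 * s)) (h j).
  by move=> k; apply/Ck_avg/smooth_partial.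
have S1 : smooth_on (nball z (3 * s)) (cst (1 : R)) by move=> k; exact: Ck_cst.
pose rho := cut Cc s0 zc S1; pose H j := cut Cc s0 zc (Sh j).
pose y j := cut Cc r0 Bc (Sy j).
(* Hadamard's expansion becomes a global identity: one factor [rho] extends the averages [h j] to
   the functions [H j], the other multiplies the coordinate differences, and both sides vanish where
   [rho] does. *)
have E : rho * rho * (f - f q *: (1 : C)) =
    \sum_j rho * (y j - y j q *: (1 : C)) * H j.
  apply: smoothFunP => q'; rewrite ev_sum !evE mulr1.
  have [rho0|/cut_neq0 [cq' q's]] := eqVneq (rho q') 0.
    by rewrite rho0 !mul0r big1// => j _; rewrite !evE rho0 !mul0r.
  have Vq' : (dom c `&` coord c @^-1` nball a r) q' by split=> //; exact: zs.
  have yE j : y j q' - y j q = coord c q' 0 j - z 0 j by rewrite !Vy.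
  under eq_bigr => j _ do rewrite !evE mulr1 yE /H /= cutoffE//.
  rewrite /rho /= !cutoffE// !mulr1.
  have := @hadamard _ _ z (3 * s) (f \o param c) (coord c q').
  rewrite /= !coordK// => -> //; last by move=> k; exact: Ck_sub (SF k).
  rewrite addrAC subrr add0r mulr_sumr; apply: eq_bigr => j _.
  rewrite /h !cutoffE//.
  move: (bump _ _ _) (avg _ _ _ _) (_ - _) => b w u; ring.
have rho1 : rho q = 1 by apply: cutoff1; rewrite ?subrr ?normr0// ltW.
(* At [q], [rho] is 1 while [f - f q] and the [y j - y j q] vanish, so Leibniz leaves Y f on the
   left and the sum of the Y (y j) (H j q) on the right. The value [H j q] is the partial derivative
   of [f] by [avg_center]. *)
have := congr1 (fun g => (Y g : C) q) E; rewrite vfM vfB vf_cst vf_sum ev_sum.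
rewrite !evE rho1 !mulr1 subrr mulr0 add0r mul1r subr0 => ->.
apply: eq_bigr => j _; rewrite 2!vfM vfB vf_cst !evE rho1 mulr1 subrr.
have -> : H j q = (chart_field Cc r0 Bc j f : C) q.
  rewrite VX// /H /= cutoff1 ?subrr ?normr0 ?(ltW s0)//.
  exact: avg_center.
ring.
Qed.

End ChartFrame.

Section Functions.
Context {R : realType} {n : nat} (M : manifold R n).
Local Notation C := (smoothFun M).
Implicit Types (c d : chart R n M) (p q : M) (f : C).

Lemma chart_at p : exists2 c, atlas c & dom c p.
Proof. exact: (@atlas_smooth _ _ M).1. Qed.

Lemma smooth_open f (O : set R) : open O -> open [set q | O (f q)].
Proof.
move=> oO; rewrite openE => p Op; have [c Ac cp] := chart_at p.
have Cf := smooth_compatible f (atlas_compatible Ac) 0.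
have nO : nbhs (coord c p) [set x | O (f (param c x))].
  apply: (Cf _ (coord_cod cp)); apply: open_nbhs_nbhs; split=> //=.
  by rewrite coordK.
have nd : nbhs p (dom c) by exact: open_nbhs_nbhs (conj (dom_open c) cp).
apply: filterS2 nd (coord_cont cp nO) => q cq /=.
by rewrite coordK.
Qed.

Lemma manifold_bump p (V : set M) : open V -> V p ->
  exists (rho : C) (W : set M), [/\ open W, W p,
    forall q, 0 <= rho q <= 1, forall q, W q -> rho q = 1 &
    forall q, rho q != 0 -> V q].
Proof.
move=> oV Vp; have [c Ac cp] := chart_at p.
have Cc := atlas_compatible Ac; set a := coord c p.
have Ua : (cod c `&` param c @^-1` V) a.
  by split; [exact: coord_cod|rewrite /= coordK].
have [r r0 BU] := nball_sub (param_open oV) Ua.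
have Bc : nball a (3 * r) `<=` cod c by move=> x /BU[].
have S1 : smooth_on (nball a (3 * r)) (cst (1 : R)) by move=> k; exact: Ck_cst.
exists (cut Cc r0 Bc S1), (dom c `&` coord c @^-1` nball a r); split.
- exact/coord_open/nball_open.
- by split=> //; rewrite /nball /= subrr normr0.
- move=> q; have [cq|cq] := pselect (dom c q).
    by rewrite /= cutoffE// mulr1 bump_ge0 bump_le1.
  by rewrite /= cutoff0 ?lexx ?ler01// => -[].
- by move=> q [cq qr]; apply: cutoff1 => //; exact: ltW.
- by move=> q /cut_neq0[cq /BU[_ /=]]; rewrite coordK.
Qed.

Lemma smooth_invsqrt f : (forall q, 0 < f q) ->
  exists g : C, forall q, g q = (Num.sqrt (f q))^-1.
Proof.
move=> f0.
suff S : (fun q => (Num.sqrt (f q))^-1) \in @smooth _ _ M.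
  by exists (SmoothFun S).
apply/asboolP => c Ac k; have Sf := smooth_compatible f (atlas_compatible Ac) k.
have oc := cod_open c.
apply: (CkV oc _ (Ck_sqrt oc _ Sf)) => x _ //=.
by rewrite gt_eqF// sqrtr_gt0.
Qed.

Lemma local_invsqrt f p : 0 < f p -> exists (g : C) (V : set M),
  [/\ open V, V p & forall q, V q -> 0 < g q /\ g q ^+ 2 * f q = 1].
Proof.
move=> fp; have oV : open [set q | 0 < f q].
  exact: (smooth_open f (@open_gt _ 0)).
have [rho [W [oW Wp rho01 rho1 rhoV]]] := manifold_bump oV fp.
(* A globally positive function that agrees with [f] where [rho] is 1; the support of [rho] lies in
   the set where [f] is positive. *)
have pos q : 0 < (rho * f + (1 - rho)) q.
  rewrite !evE; have /andP[r0 r1] := rho01 q.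
  have [->|rn0] := eqVneq (rho q) 0; first by rewrite mul0r add0r subr0.
  rewrite ltr_wpDr// ?subr_ge0// mulr_gt0//; last exact: rhoV.
  by rewrite lt_def rn0.
have [g gE] := smooth_invsqrt pos.
exists g, W; split=> // q Wq; rewrite gE invr_gt0 sqrtr_gt0 pos; split=> //.
have := pos q; rewrite !evE rho1// mul1r subrr addr0 => fq.
by rewrite exprVn sqr_sqrtr ?ltW// mulVf// gt_eqF.
Qed.

(** On a ball in coordinates where the frame is the coordinate frame, all partial derivatives of [f]
    vanish, hence so do all the averages in Hadamard's expansion. *)
Lemma deriv0_locally_constant f p : (forall X : vectorField M, X f = 0) ->
  exists V : set M, [/\ open V, V p & forall q, V q -> f q = f p].
Proof.
move=> Xf; have [c Ac cp] := chart_at p; have Cc := atlas_compatible Ac.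
have [X [y [V [oV Vp Vc _ VX]]]] := chart_frame Cc cp; set a := coord c p.
have Ua : (cod c `&` param c @^-1` V) a.
  by split; [exact: coord_cod|rewrite /= coordK].
have [r r0 BU] := nball_sub (param_open oV) Ua.
exists (dom c `&` coord c @^-1` nball a (3 * r)); split.
- exact/coord_open/nball_open.
- by split=> //; rewrite /nball /= subrr normr0 mulr_gt0.
move=> q [cq qr].
have SF : smooth_on (nball a (3 * r)) (f \o param c).
  by move=> k; apply: Ck_sub (smooth_compatible f Cc k) => x /BU[].
have := hadamard SF qr; rewrite /= !coordK// => ->.
rewrite big1 ?addr0// => i _; rewrite /avg (eq_int01 (H := cst 0)).
  by rewrite int01_cst mulr0.
move=> t t01; have [cs Vs] := BU _ (seg_nball t01 qr).
have [/(_ i f) H _] := VX _ Vs; move: H; rewrite Xf paramK// => <-.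
by rewrite mulr0.
Qed.

Lemma deriv0_constant f : connected [set: M] ->
  (forall X : vectorField M, X f = 0) -> forall p q, f q = f p.
Proof.
move=> cM Xf p q; suff : [set q | f q = f p] = [set: M].
  by move=> E; have : [set: M] q by []; rewrite -E.
have oS v : open [set q | f q = v].
  rewrite openE => s /= fs; have [V [oV Vs H]] := deriv0_locally_constant s Xf.
  by apply: filterS (open_nbhs_nbhs (conj oV Vs)) => s' /H E; rewrite /= E.
apply: cM; first by exists p.
  by exists [set q | f q = f p]; [exact: oS|rewrite setTI].
exists [set q | f q = f p]; last by rewrite setTI.
rewrite -[X in closed X]setCK; apply: open_closedC.
rewrite openE => s /= fs; have [V [oV Vs H]] := deriv0_locally_constant s Xf.
by apply: filterS (open_nbhs_nbhs (conj oV Vs)) => s' /H E; rewrite /setC /= E.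
Qed.

End Functions.

Section OrientedFrames.
Context {R : realType} {n : nat} (M : manifold R n).
Local Notation C := (smoothFun M).
Implicit Types (p q : M) (f : C) (Y : vectorField M).

Lemma diff_coord_near {m} (g : 'rV[R]_n -> 'rV[R]_m) (u : 'rV[R]_n -> R) x j v :
  differentiable g x -> (\forall y \near x, u y = g y 0 j) ->
  'd u x v = 'd g x v 0 j.
Proof.
move=> dg ug.
have dc : differentiable (fun z : 'rV[R]_m => z 0 j : R) (g x).
  exact: differentiable_coord.
have gu : \forall y \near x, g y 0 j = u y by apply: filterS ug => y ->.
have [_ ->] := diff_near_eq gu (differentiable_comp dg dc).
by have := diff_comp dg dc; rewrite /comp => ->; rewrite /= diff_coord.
Qed.

(** With charts chosen in the oriented atlas, the matrix of the frame at [p] in the coordinates at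
    [p'] is the Jacobian of the transition map, so its determinant is positive. *)
Lemma oriented_frames : orientable M ->
  exists (X : M -> 'I_n -> vectorField M) (y : M -> 'I_n -> C)
         (V : M -> set M),
  [/\ forall p, open (V p) /\ V p p,
      forall p q i j, V p q -> (X p i (y p j) : C) q = (i == j)%:R,
      forall p q Y f, V p q ->
        (Y f : C) q = \sum_j (Y (y p j) : C) q * (X p j f : C) q &
      forall p p' q, V p q -> V p' q ->
        0 < \det (\matrix_(i, j) (X p i (y p' j) : C) q)].
Proof.
move=> [A [[Acov Asm] Acomp Aor]].
have /choice[c Hc] p : exists c, A c /\ dom c p by have [c] := Acov p; exists c.
have Cc p : compatible (c p) by move=> d Ad; apply: Acomp => //; case: (Hc p).
have /choice[X HX] p := chart_frame (Cc p) (Hc p).2.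
have /choice[y Hy] := HX; have {HX} /choice[V HV] := Hy.
have nV p p' q : V p q -> V p' q -> \forall x \near coord (c p) q,
    cod (c p) x /\ V p' (param (c p) x).
  move=> Vq V'q; have [_ _ Vc _ _] := HV p; have [oV' _ _ _ _] := HV p'.
  apply: open_nbhs_nbhs; split; first exact: (param_open (c := c p) oV').
  by split; [exact/coord_cod/Vc|rewrite /= coordK//; exact: Vc].
exists X, y, V; split.
- by move=> p; have [oV Vp _ _ _] := HV p.
- move=> p q i j Vq; have [_ _ Vc yE XE] := HV p; have [-> _] := XE q Vq.
  rewrite (@diff_coord_near _ id _ _ j)//.
    by rewrite diff_val mxE eqxx eq_sym.
  by apply: filterS (nV p p q Vq Vq) => x [cx Vx]; rewrite /= yE// paramK.
- by move=> p q Y f Vq; have [_ _ _ _ XE] := HV p; have [_ ->] := XE q Vq.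
- move=> p p' q Vq V'q; have [_ _ Vc yE XE] := HV p.
  have [_ _ V'c yE' _] := HV p'.
  have := Aor _ _ q (Hc p).1 (Hc p').1 (Vc _ Vq) (V'c _ V'q).
  congr (_ < \det _); apply/matrixP => i j; rewrite !mxE.
  have [-> _] := XE q Vq; apply/esym/diff_coord_near.
    have [dT _] := Asm _ _ (Hc p).1 (Hc p').1 1; apply: dT.
    split; first exact/coord_cod/Vc.
    by rewrite /= coordK; [exact: V'c|exact: Vc].
  by apply: filterS (nV p p' q Vq V'q) => x [cx V'x]; rewrite /= yE'.
Qed.

End OrientedFrames.

(** * Tensoriality *)

Section Pointwise.
Context {R : realType} {n : nat} (M : manifold R n).
Local Notation C := (smoothFun M).
Local Notation VF := (vectorField M).
Implicit Types (p q : M) (f : C) (X Y Z : VF).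

(** Equality of the tangent vectors at [q], a tangent vector being a derivation evaluated at that
    point. *)
Definition eqat q Y Z := forall f, (Y f : C) q = (Z f : C) q.

Definition local_frame (X : 'I_n -> VF) (y : 'I_n -> C) (V : set M) :=
  [/\ open V, forall q i j, V q -> (X i (y j) : C) q = (i == j)%:R &
      forall q Y f, V q ->
        (Y f : C) q = \sum_j (Y (y j) : C) q * (X j f : C) q].

Definition module_linear (a : VF -> C) :=
  forall f Y Z, a (f *: Y + Z) = f * a Y + a Z.

Section ModuleLinear.
Context (a : VF -> C) (al : module_linear a).

Lemma mlD Y Z : a (Y + Z) = a Y + a Z.
Proof. by have := al 1 Y Z; rewrite scale1r mul1r. Qed.

Lemma ml0 : a 0 = 0.
Proof. by apply: (addrI (a 0)); rewrite -mlD !addr0. Qed.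

Lemma mlZ f Y : a (f *: Y) = f * a Y.
Proof. by have := al f Y 0; rewrite ml0 !addr0. Qed.

Lemma mlN Y : a (- Y) = - a Y.
Proof. by rewrite -scaleN1r mlZ mulN1r. Qed.

Lemma mlB Y Z : a (Y - Z) = a Y - a Z.
Proof. by rewrite mlD mlN. Qed.

Lemma ml_sum (I : Type) (s : seq I) (P : pred I) (F : I -> VF) :
  a (\sum_(i <- s | P i) F i) = \sum_(i <- s | P i) a (F i).
Proof. exact: (big_morph a mlD ml0). Qed.

(** The frame expansion of a field [W] holds only on [V]; multiplied by a bump it holds on all of
    [M], and linearity over functions then writes [a W q] through the components of [W] at [q]
    alone. *)
Lemma ml_eqat (X : 'I_n -> VF) y V q Y Z :
  local_frame X y V -> V q -> eqat q Y Z ->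
  a Y q = a Z q.
Proof.
move=> [oV _ frm] Vq YZ.
suff H W : eqat q W 0 -> a W q = 0.
  apply/eqP; rewrite -subr_eq0 -evN -evD -mlB; apply/eqP/H => f.
  by rewrite vfaddE vfoppE !evE YZ subrr.
move=> W0; have [rho [U [_ Uq _ /(_ _ Uq) rho1 rhoV]]] := manifold_bump oV Vq.
have E : rho *: W = rho *: \sum_j (W (y j) : C) *: X j.
  apply: vfP => f q'; rewrite !vfscaleE !evE.
  have [->|/rhoV Vq'] := eqVneq (rho q') 0; first by rewrite !mul0r.
  by congr (_ * _); rewrite (frm _ _ _ Vq') vfsumE ev_sum.
have := congr1 (fun Y => a Y q) E.
rewrite !mlZ !evE rho1 !mul1r ml_sum ev_sum => ->.
by rewrite big1// => j _; rewrite mlZ evE W0 mul0r.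
Qed.

End ModuleLinear.

(** The glued field acts by q |-> (Zl q f) q, with [Zl q] a local solution near [q]. By uniqueness
    this function agrees near [p] with the single smooth function [Zl p f], and the derivation rules
    are checked point by point. *)
Lemma glue_fields (P : M -> VF -> Prop) :
  (forall p, exists Z (V : set M), [/\ open V, V p & forall q, V q -> P q Z]) ->
  (forall q Z Z', P q Z -> P q Z' -> eqat q Z Z') ->
  exists Z, forall q, exists2 Zq, P q Zq & eqat q Z Zq.
Proof.
move=> loc uniqP; have /choice[Zl HZ] := loc.
have ZE p q f : (exists2 V : set M, V q & forall q', V q' -> P q' (Zl p)) ->
    (Zl q f : C) q = (Zl p f : C) q.
  move=> [V Vq PV]; have [W [_ Wq PW]] := HZ q.
  by apply: uniqP; [exact: PW|exact: PV].
have S f : (fun q => (Zl q f : C) q) \in @smooth _ _ M.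
  apply: smooth_glue => p; have [V [oV Vp PV]] := HZ p.
  by exists V; split=> //; exists (Zl p f) => q Vq; apply: ZE; exists V.
pose F f : C^o := SmoothFun (S f).
have D : F \in @derivation _ _ M.
  apply/asboolP; split=> [k f g|f g]; apply: smoothFunP => q /=.
    by rewrite vfD vfZ.
  by rewrite vfM.
exists (VectorField D) => q; exists (Zl q) => //.
by have [V [_ Vq PV]] := HZ q; exact: PV.
Qed.

End Pointwise.

Section MetricPointwise.
Context {R : realType} {n : nat} (M : manifold R n) (g : riemannian_metric M).
Local Notation C := (smoothFun M).
Local Notation VF := (vectorField M).
Implicit Types (p q : M) (f : C) (X Y Z : VF).

Lemma metric_ml Z : module_linear (g^~ Z).
Proof. by move=> f X Y; exact: metric_linear. Qed.

Lemma metric_mr Z : module_linear (g Z).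
Proof. by move=> f X Y; rewrite !(metric_sym g Z) metric_linear. Qed.

Definition gDl Z := mlD (metric_ml Z).
Definition gZl Z := mlZ (metric_ml Z).
Definition gNl Z := mlN (metric_ml Z).
Definition gBl Z := mlB (metric_ml Z).
Definition g0l Z := ml0 (metric_ml Z).
Definition gDr Z := mlD (metric_mr Z).
Definition gZr Z := mlZ (metric_mr Z).
Definition gNr Z := mlN (metric_mr Z).
Definition g0r Z := ml0 (metric_mr Z).

Lemma metric_nondeg q Z Z' : (forall Y, g Z Y q = g Z' Y q) -> eqat q Z Z'.
Proof.
move=> H f; apply/eqP; rewrite -subr_eq0; apply/negPn/negP => Hf.
have : 0 < g (Z - Z') (Z - Z') q.
  by apply: metric_pos; exists f; rewrite vfaddE vfoppE !evE.
by rewrite gBl !evE H subrr ltxx.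
Qed.

Lemma metric_inj Z Z' : (forall Y, g Z Y = g Z' Y) -> Z = Z'.
Proof.
by move=> H; apply: vfP => f q; apply: metric_nondeg => Y; rewrite H.
Qed.

Lemma metric_eq0 Z : (forall q, g Z Z q <= 0) -> Z = 0.
Proof.
move=> H; apply: vfP => f q; apply/eqP/negPn/negP => Zf.
have : 0 < g Z Z q by apply: metric_pos; exists f.
by rewrite ltNge H.
Qed.

Definition ortho q (e : 'I_n -> VF) :=
  forall i j, g (e i) (e j) q = (i == j)%:R.

(** A dimension count in matrix form: if T holds the components of the [e i] and G is the Gram
    matrix of the frame, orthonormality says T (G T^T) = 1, and for square matrices this implies (G
    T^T) T = 1, which is the expansion. *)
Lemma ortho_complete (X : 'I_n -> VF) y V q e :
  local_frame X y V -> V q -> ortho q e ->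
  forall Y, eqat q Y (\sum_j g Y (e j) *: e j).
Proof.
move=> frm Vq oe Y f; have [_ _ XE] := frm.
have gE Z W : g Z W q = \sum_k (Z (y k) : C) q * g (X k) W q.
  have : eqat q Z (\sum_k (Z (y k) : C) *: X k).
    by move=> h; rewrite XE// vfsumE ev_sum.
  move=> /(ml_eqat (metric_ml W) frm Vq) ->; rewrite (ml_sum (metric_ml W)).
  by rewrite ev_sum; apply: eq_bigr => k _; rewrite gZl.
pose T := \matrix_(i, k) (e i (y k) : C) q.
pose G := \matrix_(k, l) g (X k) (X l) q.
pose u := \row_k (Y (y k) : C) q; pose w := \col_k (X k f : C) q.
have XG k j : g (X k) (e j) q = (G *m T^T) k j.
  rewrite metric_sym gE !mxE; apply: eq_bigr => l _.
  by rewrite !mxE mulrC metric_sym.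
have TGT : T *m (G *m T^T) = 1%:M.
  apply/matrixP => i j; rewrite !mxE -oe gE.
  by apply: eq_bigr => k _; rewrite XG mxE.
have GTT := mulmx1C TGT.
have -> : (Y f : C) q = (u *m w) 0 0.
  by rewrite XE// mxE; apply: eq_bigr => k _; rewrite !mxE.
rewrite -[w]mul1mx -GTT !mulmxA -mulmxA vfsumE ev_sum mxE.
apply: eq_bigr => j _; rewrite vfscaleE !evE; congr (_ * _).
  by rewrite -mulmxA gE mxE; apply: eq_bigr => k _; rewrite XG !mxE.
by rewrite XE// mxE; apply: eq_bigr => k _; rewrite !mxE.
Qed.

End MetricPointwise.

(** * Orthonormal frames in dimension 3 *)

Section Dimension3.

Definition o0 : 'I_3 := @Ordinal 3 0 isT.
Definition o1 : 'I_3 := @Ordinal 3 1 isT.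
Definition o2 : 'I_3 := @Ordinal 3 2 isT.

Lemma ord3_ind (P : 'I_3 -> Prop) : P o0 -> P o1 -> P o2 -> forall i, P i.
Proof.
move=> P0 P1 P2 [[|[|[|//]]] lt]; [move: P0|move: P1|move: P2];
  by congr P; exact: val_inj.
Qed.

Lemma sum3 (V : nmodType) (F : 'I_3 -> V) : \sum_i F i = F o0 + F o1 + F o2.
Proof.
rewrite !big_ord_recl big_ord0 addr0 addrA.
by congr (F _ + F _ + F _); exact: val_inj.
Qed.

Definition triple {T} (a b c : T) (i : 'I_3) : T :=
  if i == o0 then a else if i == o1 then b else c.

Lemma tripleE {T} (a b c : T) :
  (triple a b c o0 = a) * (triple a b c o1 = b) * (triple a b c o2 = c).
Proof. by []. Qed.

Lemma det3 (K : comNzRingType) (A : 'M[K]_3) : \det A =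
  A o0 o0 * (A o1 o1 * A o2 o2 - A o1 o2 * A o2 o1)
  - A o0 o1 * (A o1 o0 * A o2 o2 - A o1 o2 * A o2 o0)
  + A o0 o2 * (A o1 o0 * A o2 o1 - A o1 o1 * A o2 o0).
Proof.
rewrite (expand_det_row _ o0) sum3 /cofactor.
rewrite !(expand_det_row _ ord0) !big_ord_recl !big_ord0 /cofactor.
rewrite !det_mx11 !mxE.
rewrite /= !(expr0, expr1, expr2, mulN1r, mul1r, addr0, add0n).
have E i j i' j' : val i = val i' -> val j = val j' -> A i j = A i' j'.
  by move=> /val_inj -> /val_inj ->.
rewrite (E (lift o0 ord0) (lift o0 ord0) o1 o1 erefl erefl)
  (E (lift o0 (lift ord0 0)) (lift o0 (lift ord0 0)) o2 o2 erefl erefl)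
  (E (lift o0 ord0) (lift o0 (lift ord0 ord0)) o1 o2 erefl erefl)
  (E (lift o0 (lift ord0 0)) (lift o0 (lift (lift ord0 ord0) 0))
    o2 o1 erefl erefl)
  (E (lift o0 ord0) (lift o1 ord0) o1 o0 erefl erefl)
  (E (lift o0 (lift ord0 0)) (lift o1 (lift ord0 0)) o2 o2 erefl erefl)
  (E (lift o0 ord0) (lift o1 (lift ord0 ord0)) o1 o2 erefl erefl)
  (E (lift o0 (lift ord0 0)) (lift o1 (lift (lift ord0 ord0) 0))
    o2 o0 erefl erefl)
  (E (lift o0 ord0) (lift o2 ord0) o1 o0 erefl erefl)
  (E (lift o0 (lift ord0 0)) (lift o2 (lift ord0 0)) o2 o1 erefl erefl)
  (E (lift o0 ord0) (lift o2 (lift ord0 ord0)) o1 o1 erefl erefl)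
  (E (lift o0 (lift ord0 0)) (lift o2 (lift (lift ord0 ord0) 0))
    o2 o0 erefl erefl); ring.
Qed.

End Dimension3.

Section GramSchmidt.
Context {R : realType} (M : manifold R 3) (g : riemannian_metric M).
Local Notation C := (smoothFun M).
Local Notation VF := (vectorField M).
Implicit Types (p q : M) (f : C) (Y Z : VF).

Lemma normalize p Z f : (Z f : C) p != 0 ->
  exists (s : C) (V : set M), [/\ open V, V p &
    forall q, V q -> 0 < s q /\ g (s *: Z) (s *: Z) q = 1].
Proof.
move=> Zf; have : 0 < g Z Z p by apply: metric_pos; exists f.
move=> /local_invsqrt[s [V [oV Vp H]]]; exists s, V; split=> // q /H[s0 sE].
by split=> //; rewrite gZl gZr !evE mulrA -expr2.
Qed.

Lemma gram_schmidt p (X : 'I_3 -> VF) y V : local_frame X y V -> V p ->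
  exists (e : 'I_3 -> VF) (W : set M), [/\ open W, W p, W `<=` V &
    forall q, W q -> ortho g q e /\
      0 < \det (\matrix_(i, j) (e i (y j) : C) q)].
Proof.
move=> [oV Xy _] Vp.
have [|s0 [V0 [oV0 V0p H0]]] := @normalize p (X o0) (y o0).
  by rewrite Xy// oner_neq0.
pose e0 := s0 *: X o0.
pose Z1 := X o1 - g (X o1) e0 *: e0.
have [|s1 [V1 [oV1 V1p H1]]] := @normalize p Z1 (y o1).
  by rewrite !vfE !evE !Xy//= !mulr0 subr0 oner_neq0.
pose e1 := s1 *: Z1.
pose Z2 := X o2 - g (X o2) e0 *: e0 - g (X o2) e1 *: e1.
have [|s2 [V2 [oV2 V2p H2]]] := @normalize p Z2 (y o2).
  by rewrite !vfE !evE !Xy//= !(mulr0, subr0) oner_neq0.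
pose e2 := s2 *: Z2.
exists (triple e0 e1 e2), (V `&` (V0 `&` (V1 `&` V2))); split.
- by do !apply: openI.
- by [].
- by move=> q [].
move=> q [Vq [V0q [V1q V2q]]].
have [s0q E00] := H0 q V0q; have [s1q E11] := H1 q V1q.
have [s2q E22] := H2 q V2q.
rewrite -/e0 in E00; rewrite -/e1 in E11; rewrite -/e2 in E22.
have E10 : g e1 e0 q = 0.
  by rewrite gZl gBl gZl !evE E00 mulr1 subrr mulr0.
have E20 : g e2 e0 q = 0.
  rewrite gZl !gBl [g (_ *: e0) _]gZl [g (_ *: e1) _]gZl !evE E00 -/e1 E10.
  by rewrite mulr1 mulr0 subr0 subrr mulr0.
have E01 : g e0 e1 q = 0 by rewrite metric_sym.
have E21 : g e2 e1 q = 0.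
  rewrite gZl !gBl [g (_ *: e0) _]gZl [g (_ *: e1) _]gZl !evE E11 E01.
  by rewrite mulr1 mulr0 subr0 subrr mulr0.
have E02 : g e0 e2 q = 0 by rewrite metric_sym.
have E12 : g e1 e2 q = 0 by rewrite metric_sym.
split; first by elim/ord3_ind; elim/ord3_ind.
have y0 j : (e0 (y j) : C) q = s0 q * (o0 == j)%:R by rewrite !vfE !evE Xy.
have y1 j : (e1 (y j) : C) q =
    s1 q * ((o1 == j)%:R - g (X o1) e0 q * (e0 (y j) : C) q).
  by rewrite !vfE !evE Xy.
have y2 j : (e2 (y j) : C) q =
    s2 q * ((o2 == j)%:R - g (X o2) e0 q * (e0 (y j) : C) q
                         - g (X o2) e1 q * (e1 (y j) : C) q).
  by rewrite !vfE !evE Xy.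
(* The matrix is lower triangular with the positive normalising factors [s0], [s1], [s2] on the
   diagonal. *)
rewrite det3 !mxE !tripleE !y2 !y1 !y0 /=.
rewrite !(mulr0, subr0, mulr1, mul0r, addr0).
by rewrite !mulr_gt0.
Qed.

End GramSchmidt.

Section OrthonormalFrames.
Context {R : realType} (M : manifold R 3) (g : riemannian_metric M).
Local Notation C := (smoothFun M).
Local Notation VF := (vectorField M).
Implicit Types (p q : M) (f : C) (Y Z : VF) (e : 'I_3 -> VF).

Definition framed := forall p, exists X y (V : set M), local_frame X y V /\ V p.

Context (M_framed : framed).

Lemma ml_at a q Y Z : module_linear a -> eqat q Y Z -> a Y q = a Z q.
Proof.
move=> al YZ; have [X [y [V [frm Vq]]]] := M_framed q.
exact: (ml_eqat al frm Vq).
Qed.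

Lemma orthonormal_near p : exists e (W : set M),
  [/\ open W, W p & forall q, W q -> ortho g q e].
Proof.
have [X [y [V [frm Vp]]]] := M_framed p.
have [e [W [oW Wp _ H]]] := gram_schmidt g frm Vp.
by exists e, W; split=> // q /H[].
Qed.

Section AtPoint.
Context (q : M) (e : 'I_3 -> VF) (oe : ortho g q e).

Lemma ortho_expand Y : eqat q Y (\sum_j g Y (e j) *: e j).
Proof.
have [X [y [V [frm Vq]]]] := M_framed q.
exact: (ortho_complete frm Vq oe).
Qed.

Lemma ml_expand a Y : module_linear a ->
  a Y q = \sum_j g Y (e j) q * a (e j) q.
Proof.
move=> al; rewrite (ml_at al (ortho_expand Y)) (ml_sum al) ev_sum.
by apply: eq_bigr => j _; rewrite (mlZ al).
Qed.

Lemma parseval Y Z : g Y Z q = \sum_j g Y (e j) q * g Z (e j) q.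
Proof.
rewrite (ml_expand Y (metric_ml g Z)); apply: eq_bigr => j _.
by rewrite (metric_sym g (e j)).
Qed.

End AtPoint.

(** Riesz duality for the metric: the sum of the [a (e j) *: e j] solves the problem in a local
    orthonormal frame, and nondegeneracy gives the pointwise uniqueness needed for gluing. *)
Lemma sharp a : module_linear a -> exists W, forall Y, g W Y = a Y.
Proof.
move=> al; have [|q Z Z' PZ PZ'|W HW] :=
    @glue_fields _ _ M (fun q W => forall Y, g W Y q = a Y q).
- move=> p; have [e [V [oV Vp oe]]] := orthonormal_near p.
  exists (\sum_j a (e j) *: e j), V; split=> // q Vq Y.
  rewrite (ml_sum (metric_ml g Y)) ev_sum (ml_expand (oe q Vq) Y al).
  by apply: eq_bigr => j _; rewrite gZl evE mulrC metric_sym.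
- by apply: (@metric_nondeg _ _ _ g) => Y; rewrite PZ PZ'.
exists W => Y; apply: smoothFunP => q; have [Wq <- E] := HW q.
exact: ml_at (metric_ml g Y) E.
Qed.

Lemma ortho_change q e e' : ortho g q e -> ortho g q e' ->
  forall (a : VF -> C) i, module_linear a ->
  a (e i) q = \sum_j (\matrix_(i, j) g (e i) (e' j) q) i j * a (e' j) q.
Proof.
move=> oe oe' a i al; rewrite (ml_expand oe' (e i) al).
by apply: eq_bigr => j _; rewrite mxE.
Qed.

(* Both frames have a positive determinant with respect to the same
   coordinates, so the orthogonal matrix between them is a rotation. *)
Lemma ortho_det q e e' (y : 'I_3 -> C) : ortho g q e -> ortho g q e' ->
  0 < \det (\matrix_(i, j) (e i (y j) : C) q) ->
  0 < \det (\matrix_(i, j) (e' i (y j) : C) q) ->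
  \det (\matrix_(i, j) g (e i) (e' j) q) = 1.
Proof.
move=> oe oe'; set O := \matrix_(i, j) g (e i) (e' j) q.
set E := (X in 0 < \det X -> _); set E' := (X in _ -> 0 < \det X -> _).
have -> : E = O *m E'.
  apply/matrixP => i j; rewrite !mxE (ortho_expand oe' (e i)) vfsumE ev_sum.
  by apply: eq_bigr => k _; rewrite vfscaleE !evE !mxE.
have OO : O *m O^T = 1%:M.
  apply/matrixP => i j; rewrite !mxE -oe (parseval oe').
  by apply: eq_bigr => k _; rewrite !mxE.
rewrite det_mulmx => dE dE'; rewrite pmulr_lgt0// in dE.
have := congr1 determinant OO; rewrite det_mulmx det_tr det1 => /eqP.
rewrite -expr2 sqrf_eq1 => /orP[/eqP//|/eqP dO].
by move: dE; rewrite dO ltr0N1.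
Qed.

End OrthonormalFrames.

(** * The axis of a skew-symmetric endomorphism *)

Section Axis.
Context {R : realType} (M : manifold R 3) (g : riemannian_metric M).
Local Notation C := (smoothFun M).
Local Notation VF := (vectorField M).
Implicit Types (p q : M) (f : C) (Y Z : VF) (e : 'I_3 -> VF).

Lemma orientable_framed : orientable M -> framed M.
Proof.
move=> /oriented_frames[X [y [V [VV Xy XE _]]]] p; exists (X p), (y p), (V p).
by have [oV Vp] := VV p; split=> //; split=> // *; [exact: Xy|exact: XE].
Qed.

Section Skew.
Context (theta : endo M) (skew : skew_symmetric g theta).

Lemma skew_form Y Z : g (theta Y) Z = - g (theta Z) Y.
Proof. by rewrite skew metric_sym. Qed.

Lemma skew_form0 q Y : g (theta Y) Y q = 0.
Proof.
have := congr1 (fun f : C => f q) (skew_form Y Y); rewrite evN => /eqP.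
by rewrite -subr_eq0 opprK -mulr2n mulrn_eq0 => /eqP.
Qed.

Lemma theta_ml Z : module_linear (fun Y => g (theta Y) Z).
Proof. by move=> f Y Y'; rewrite linearP metric_linear. Qed.

(* The vector field v with theta Y = v x Y, read in an oriented orthonormal
   frame. *)
Definition axis e : VF :=
  g (theta (e o1)) (e o2) *: e o0 - g (theta (e o0)) (e o2) *: e o1 +
  g (theta (e o0)) (e o1) *: e o2.

Lemma axisE e Y q : g (axis e) Y q =
  g (theta (e o1)) (e o2) q * g (e o0) Y q
  - g (theta (e o0)) (e o2) q * g (e o1) Y q
  + g (theta (e o0)) (e o1) q * g (e o2) Y q.
Proof. by rewrite gDl gBl !gZl !evE. Qed.

Lemma axis_indep q e e' : framed M -> ortho g q e -> ortho g q e' ->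
  \det (\matrix_(i, j) g (e i) (e' j) q) = 1 -> eqat q (axis e) (axis e').
Proof.
move=> fr oe oe' dO; apply: (@metric_nondeg _ _ _ g) => Y; rewrite !axisE.
set O := \matrix_(i, j) g (e i) (e' j) q in dO.
have gE i : g (e i) Y q = \sum_j O i j * g (e' j) Y q.
  exact: (ortho_change fr oe oe' i (metric_ml g Y)).
have tE i j : g (theta (e i)) (e j) q =
    \sum_k O i k * \sum_l O j l * g (theta (e' k)) (e' l) q.
  rewrite (ortho_change fr oe oe' i (theta_ml (e j))); apply: eq_bigr => k _.
  congr (_ * _); exact: (ortho_change fr oe oe' j (metric_mr g _)).
(* Replacing 1 by det O turns the goal into axis e = det O axis e', a polynomial identity in the
   entries of [O] that follows from the skewness of [theta] alone. *)
rewrite -[RHS]mul1r -{}dO det3 !gE !tE !sum3 !skew_form0.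
have sk i j : g (theta (e' i)) (e' j) q = - g (theta (e' j)) (e' i) q.
  by rewrite skew_form.
rewrite (sk o1 o0) (sk o2 o0) (sk o2 o1).
move: (O o0 o0) (O o0 o1) (O o0 o2) (O o1 o0) (O o1 o1) (O o1 o2) (O o2 o0)
  (O o2 o1) (O o2 o2) (g _ _ q) (g _ _ q) (g _ _ q) (g _ _ q) (g _ _ q)
  (g _ _ q) => *; ring.
Qed.

(** Lagrange's identity for (v x Y) . (v x Z), checked in components. *)
Lemma axis_square q e Y Z : framed M -> ortho g q e ->
  g (theta Y) (theta Z) q = g (axis e) (axis e) q * g Y Z q
    - g (axis e) Y q * g (axis e) Z q.
Proof.
move=> fr oe.
have tE W k : g (theta W) (e k) q =
    \sum_i g W (e i) q * g (theta (e i)) (e k) q.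
  exact: (ml_expand fr oe W (theta_ml (e k))).
have sk i j : g (theta (e i)) (e j) q = - g (theta (e j)) (e i) q.
  by rewrite skew_form.
rewrite (parseval fr oe (theta Y)) (parseval fr oe Y).
have ea i : g (e i) (axis e) q = g (axis e) (e i) q by rewrite metric_sym.
have eY i : g (e i) Y q = g Y (e i) q by rewrite metric_sym.
have eZ i : g (e i) Z q = g Z (e i) q by rewrite metric_sym.
rewrite !(axisE _ (axis e)) !ea !axisE !oe !eY !eZ.
rewrite !sum3 !tE !sum3 !oe !skew_form0 (sk o1 o0) (sk o2 o0) (sk o2 o1) /=.
move: (g Y _ q) (g Y _ q) (g Y _ q) (g Z _ q) (g Z _ q) (g Z _ q).
move: (g _ _ q) (g _ _ q) (g _ _ q) => *; ring.
Qed.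

(** The axis is prescribed at [q] by the orthonormal frames that are positive for the coordinates
    [y q]. [ortho_det] and [axis_indep] make it unique; skewness then turns Lagrange's identity into
    the formula for [theta] squared. *)
Lemma axis_exists : orientable M -> exists v : VF,
  forall Y, theta (theta Y) = - (g v v *: Y) + g v Y *: v.
Proof.
move=> oM; have fr := orientable_framed oM.
have [X [y [V [VV Xy XE dX]]]] := oriented_frames oM.
pose P q W := exists e, [/\ ortho g q e,
  0 < \det (\matrix_(i, j) (e i (y q j) : C) q) & eqat q W (axis e)].
have [|q Z Z'|v Hv] := @glue_fields _ _ M P.
- move=> p; have [oV Vp] := VV p.
  have frm : local_frame (X p) (y p) (V p).
    by split=> // *; [exact: Xy|exact: XE].
  have [e [W [oW Wp WV H]]] := gram_schmidt g frm Vp.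
  exists (axis e), W; split=> // q Wq; have [oe de] := H q Wq.
  exists e; split=> //; have [_ Vq] := VV q.
  (* The frame built near [p] is positive for [y p]; multiplying its determinant by that of the
     positive change from [X p] to [y q] shows that it is positive for [y q] too. *)
  have := dX _ _ _ (WV _ Wq) Vq; rewrite -(pmulr_rgt0 _ de) -det_mulmx.
  congr (_ < \det _); apply/matrixP => i j.
  rewrite !mxE (XE _ _ _ _ (WV _ Wq)).
  by apply: eq_bigr => k _; rewrite !mxE.
- move=> [e [oe de Ze]] [e' [oe' de' Ze']] f; rewrite Ze Ze'.
  by apply: axis_indep => //; exact: ortho_det de de'.
exists v => Y; apply: (@metric_inj _ _ _ g) => Z; apply: smoothFunP => q.
have [vq [e [oe _ ve]] vvq] := Hv q.
have va : eqat q v (axis e) by move=> f; rewrite vvq ve.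
have gv W : g v W q = g (axis e) W q by exact: (ml_at fr (metric_ml g W) va).
rewrite gDl gNl !gZl !evE !gv skew evN (axis_square Y Z fr oe).
by rewrite (metric_sym g (axis e) v) gv opprB addrC.
Qed.

End Skew.

End Axis.

(** * From parallel endomorphisms to coKahler structures *)

Section Connections.
Context {R : realType} {n : nat} (M : manifold R n).
Local Notation C := (smoothFun M).
Local Notation VF := (vectorField M).
Implicit Types (p q : M) (f : C) (W X Y Z : VF) (D : affine_connection M).

Lemma nablaDr D X Y Z : D X (Y + Z) = D X Y + D X Z.
Proof. exact: nabla_additive. Qed.

Lemma nabla0r D X : D X 0 = 0.
Proof. by apply: (addrI (D X 0)); rewrite -nablaDr !addr0. Qed.

Lemma nablaNr D X Y : D X (- Y) = - D X Y.
Proof. by apply: (addrI (D X Y)); rewrite -nablaDr !subrr nabla0r. Qed.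

Lemma nablaZr D X f Y : D X (f *: Y) = (X f : C) *: Y + f *: D X Y.
Proof. exact: nabla_leibniz. Qed.

Lemma nablaZr_cst D X (k : R) Y :
  D X ((k *: (1 : C)) *: Y) = (k *: (1 : C)) *: D X Y.
Proof. by rewrite nablaZr vf_cst scale0r add0r. Qed.

Lemma parallelE D theta X Y : parallel D theta -> D X (theta Y) = theta (D X Y).
Proof. by move=> /(_ X Y)/eqP; rewrite subr_eq0 => /eqP. Qed.

End Connections.

Section AlmostContact.
Context {R : realType} {n : nat} (M : manifold R n).
Local Notation C := (smoothFun M).
Local Notation VF := (vectorField M).
Context (S : almost_contact_metric M).
Implicit Types (p q : M) (f : C) (W X Y Z : VF).
Local Notation g := (acm_g S).
Local Notation xi := (acm_xi S).
Local Notation eta := (acm_eta S).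
Local Notation th := (acm_theta S).

Lemma etaZ f X : eta (f *: X) = f * eta X.
Proof. exact: linearZ. Qed.

(** The formula for the square gives theta^2 xi = 0, and then, applied to theta xi, gives theta xi =
    a xi with a = eta (theta xi). Hence a^2 = 0, and the real-valued function a vanishes. *)
Lemma theta_xi : th xi = 0.
Proof.
have t2 : th (th xi) = 0 by rewrite acm_theta2 acm_eta_xi scale1r addNr.
have E : th xi = eta (th xi) *: xi.
  have := acm_theta2 S (th xi); rewrite t2 linear0 => /eqP.
  by rewrite eq_sym addrC subr_eq0 => /eqP.
have aa : eta (th xi) * eta (th xi) = 0.
  have := t2; rewrite {1}E linearZ /= {2}E scalerA => /(congr1 eta).
  by rewrite etaZ acm_eta_xi mulr1 linear0.
suff a0 : eta (th xi) = 0 by rewrite E a0 scale0r.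
apply: smoothFunP => q; have := congr1 (fun f : C => f q) aa.
by rewrite !evE => /eqP; rewrite mulf_eq0 => /orP[]/eqP.
Qed.

Lemma metric_xi X : g X xi = eta X.
Proof.
have := acm_compat S X xi; rewrite theta_xi g0r acm_eta_xi mulr1 => /eqP.
by rewrite eq_sym subr_eq0 => /eqP.
Qed.

Lemma eta_theta X : eta (th X) = 0.
Proof.
have : th (th (th X)) = - th X.
  by rewrite (acm_theta2 S X) linearD linearN linearZ /= theta_xi scaler0 addr0.
rewrite acm_theta2 => /eqP; rewrite -subr_eq0 addrAC subrr add0r => /eqP.
by move=> /(congr1 eta); rewrite etaZ acm_eta_xi mulr1 linear0.
Qed.

Lemma acm_skew : skew_symmetric g th.
Proof.
move=> X Y; have := acm_compat S (th X) Y.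
rewrite eta_theta mul0r subr0 => <-; rewrite acm_theta2 gDl gNl gZl.
by rewrite (metric_sym g xi) metric_xi eta_theta mulr0 addr0.
Qed.

(** A torsion-free connection replaces every bracket by covariant derivatives. As [theta], [xi] and
    the metric are parallel, all terms of d eta, d Omega and the Nijenhuis tensor cancel. *)
Lemma coKahler_of_parallel D : levi_civita g D -> parallel D th ->
  (forall X, D X xi = 0) -> coKahler S.
Proof.
move=> [tf mc] par Dxi.
have lieE X Y : lie X Y = D X Y - D Y X by rewrite tf.
have etaE X Y : X (eta Y) = eta (D X Y) :> C.
  by rewrite -!metric_xi mc Dxi g0r addr0.
have d1E X Y : d1 eta X Y = 0.
  by rewrite /d1 !etaE lieE linearB /= subrr.
split; first split=> // X Y Z.
  have fE W X' Y' : W (fundamental_form S X' Y') =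
      fundamental_form S (D W X') Y' + fundamental_form S X' (D W Y') :> C.
    by rewrite /fundamental_form mc (parallelE _ _ par).
  have fs X' Y' q : fundamental_form S X' Y' q = - fundamental_form S Y' X' q.
    by rewrite /fundamental_form acm_skew metric_sym evN.
  have fB X' Y' Z' : fundamental_form S (X' - Y') Z' =
      fundamental_form S X' Z' - fundamental_form S Y' Z'.
    by rewrite /fundamental_form linearB /= gBl.
  rewrite /d2 !lieE !fB !fE; apply: smoothFunP => q; rewrite !evE.
  rewrite (fs Y (D X Z)) (fs Z (D Y X)) (fs X (D Z Y)); ring.
move=> X Y; rewrite d1E scale0r addr0 /nijenhuis !lieE.
rewrite !(parallelE _ _ par).
do 3!rewrite ?(linearB, linearD) /=.
apply: (@metric_inj _ _ _ g) => Z; apply: smoothFunP => q.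
rewrite !(gDl, gBl, gNl, g0l, evE); ring.
Qed.

End AlmostContact.

Section ParallelSkew.
Context {R : realType} (M : manifold R 3) (g : riemannian_metric M).
Local Notation C := (smoothFun M).
Local Notation VF := (vectorField M).
Implicit Types (p q : M) (f : C) (W X Y Z : VF).
Context (D : affine_connection M) (theta : endo M).
Context (M_connected : connected [set: M]) (M_orientable : orientable M).
Context (LC : levi_civita g D) (skew : skew_symmetric g theta)
  (par : parallel D theta).

Section AxisField.
Context (v : VF) (vE : forall Y, theta (theta Y) = - (g v v *: Y) + g v Y *: v).

(** The covariant derivative of [vE]: as [theta] is parallel, the terms in [D Y X] are those of [vE]
    at [D Y X] and drop out. *)
Lemma axis_derivative X Y :
  ((Y (g v v) : C) *: X) = g (D Y v) X *: v + g v X *: D Y v.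
Proof.
have [_ mc] := LC.
have := congr1 (D Y) (vE X); rewrite !(parallelE _ _ par) vE.
rewrite nablaDr nablaNr !nablaZr mc mc => H.
apply: (@metric_inj _ _ _ g) => Z; apply: smoothFunP => q.
have := congr1 (fun W => g W Z q) H.
rewrite !(gDl, gNl, gZl, evE) => {}H.
by apply: (addrI (- (g v v q * g (D Y X) Z q))); move: H; lra.
Qed.

(** Pairing [axis_derivative] at X = e_i with e_i gives Y |v|^2 = 2 <D_Y v, e_i> <v, e_i>. The sum
    over the three indices is 3 Y |v|^2 = 2 <D_Y v, v> = Y |v|^2, so the derivative is 0. *)
Lemma axis_norm_derivative Y : Y (g v v) = 0.
Proof.
have [_ mc] := LC; have fr := orientable_framed M_orientable.
apply: smoothFunP => q; have [e [W [_ Wq oW]]] := orthonormal_near g fr q.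
have oe := oW q Wq.
have tr i : (Y (g v v) : C) q = 2 * (g (D Y v) (e i) q * g v (e i) q).
  have := congr1 (fun W => g W (e i) q) (axis_derivative (e i) Y).
  rewrite gDl !gZl !evE oe eqxx mulr1 => ->; ring.
have L : (Y (g v v) : C) q = 2 * g (D Y v) v q.
  by rewrite mc (metric_sym g v) evD mulrDl mul1r.
have := parseval fr oe (D Y v) v; rewrite sum3 ev0.
have := tr o0; have := tr o1; have := tr o2; lra.
Qed.

(** If |v|^2 vanished at one point it would vanish everywhere, being constant. Then v = 0 and
    theta^2 = 0, and |theta X|^2 = -<X, theta^2 X> forces theta = 0. *)
Lemma axis_norm_gt0 p : (exists X, theta X <> 0) -> 0 < g v v p.
Proof.
move=> [X X0]; rewrite ltNge; apply/negP => vp; apply: X0.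
have v0 : v = 0.
  apply: (@metric_eq0 _ _ _ g) => q.
  by rewrite (deriv0_constant M_connected axis_norm_derivative p).
apply: (@metric_eq0 _ _ _ g) => q.
by rewrite skew vE v0 !g0l scale0r scaler0 oppr0 addr0 g0r oppr0.
Qed.

(** Take X = v in [axis_derivative]: the left side and <D_Y v, v> vanish, which leaves |v|^2 D_Y v =
    0. *)
Lemma axis_parallel Y : (exists X, theta X <> 0) -> D Y v = 0.
Proof.
move=> tX; have [_ mc] := LC.
have Dv0 q : g (D Y v) v q = 0.
  have := congr1 (fun f : C => f q) (axis_norm_derivative Y).
  by rewrite mc (metric_sym g v) evD ev0 => E; lra.
apply: (@metric_inj _ _ _ g) => Z; apply: smoothFunP => q.
have := congr1 (fun W => g W Z q) (axis_derivative v Y).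
rewrite axis_norm_derivative scale0r g0l gDl !gZl !evE Dv0 mul0r add0r.
move=> /esym/eqP; rewrite mulf_eq0 gt_eqF ?axis_norm_gt0//=.
by move=> /eqP.
Qed.

End AxisField.

Lemma coKahler_exists : (exists X, theta X <> 0) ->
  exists S : almost_contact_metric M, coKahler S.
Proof.
move=> tX; have [v vE] := axis_exists skew M_orientable.
have [p _] := @manifold_nonempty _ _ M.
have l0 := axis_norm_gt0 vE p tX; set l := g v v p in l0.
have lE : g v v = l *: (1 : C).
  apply: smoothFunP => q; rewrite !evE mulr1.
  exact: deriv0_constant M_connected (axis_norm_derivative vE) _ _.
(* The factor 1/|v| makes [xi] a unit vector and turns theta^2 = -|v|^2 on the orthogonal complement
   of [v] into -1. *)
pose k := (Num.sqrt l)^-1.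
have kkl : k * k * l = 1.
  by rewrite -expr2 exprVn sqr_sqrtr ?ltW// mulVf// gt_eqF.
pose c : C := k *: (1 : C).
have ccl : c * c * (l *: (1 : C)) = 1.
  by apply: smoothFunP => q; rewrite !evE !mulr1.
have thl : linear (fun X => c *: theta X).
  by move=> f X Y; rewrite linearP scalerDr !scalerA mulrC.
pose thM := GRing.isLinear.Build C VF VF *:%R (fun X => c *: theta X) thl.
pose th : endo M := HB.pack (fun X => c *: theta X) thM.
pose xi := c *: v.
have etl : linear (g xi : VF -> C^o) by move=> f X Y; exact: metric_mr.
pose etM := GRing.isLinear.Build C VF C^o *:%R (g xi : VF -> C^o) etl.
pose eta : form1 M := HB.pack (g xi : VF -> C^o) etM.
have etaE X : eta X = g xi X by [].
have thE X : th X = c *: theta X by [].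
have eta_xi : eta xi = 1 by rewrite etaE gZl gZr lE mulrA.
have th2 X : th (th X) = - X + eta X *: xi.
  rewrite etaE !thE linearZ /= scalerA vE lE scalerDr scalerN !scalerA ccl.
  rewrite scale1r.
  by rewrite gZl mulrAC.
have compat X Y : g (th X) (th Y) = g X Y - eta X * eta Y.
  have -> : g (th X) (th Y) = - g X (th (th Y)).
    rewrite (thE X) gZl skew (thE (th Y)) gZr mulrN.
    by rewrite !thE.
  by rewrite th2 gDr gNr gZr opprD opprK !etaE (metric_sym g X xi) mulrC.
pose S := AlmostContactMetric eta_xi th2 compat.
exists S; apply: (@coKahler_of_parallel _ _ _ S D LC) => [X Y|X].
  by rewrite /cov_endo /= nablaZr_cst (parallelE _ _ par) subrr.
by rewrite /= nablaZr_cst axis_parallel// scaler0.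
Qed.

End ParallelSkew.

(** * The Levi-Civita connection *)

Section LeviCivita.
Context {R : realType} (M : manifold R 3) (g : riemannian_metric M).
Local Notation C := (smoothFun M).
Local Notation VF := (vectorField M).
Implicit Types (p q : M) (f : C) (W X Y Z : VF).

Lemma lieE X Y f : lie X Y f = X (Y f) - Y (X f) :> C.
Proof. by []. Qed.

Lemma lieNC X Y : lie X Y = - lie Y X.
Proof. by apply: vfP => f q; rewrite vfoppE !lieE opprB. Qed.

Lemma lie_lr X f Y Z :
  lie X (f *: Y + Z) = (X f : C) *: Y + f *: lie X Y + lie X Z.
Proof.
apply: vfP => h q; rewrite !(vfaddE, vfscaleE, lieE) vfD vfM !evE; ring.
Qed.

Lemma lie_ll X f Y Z :
  lie (f *: Y + Z) X = f *: lie Y X - (X f : C) *: Y + lie Z X.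
Proof.
apply: vfP => h q.
rewrite !(vfaddE, vfoppE, vfscaleE, lieE) vfD vfM !evE; ring.
Qed.

Definition koszul X Y Z : C := 2^-1 *: (X (g Y Z) + Y (g X Z) - Z (g X Y)
  + g (lie X Y) Z - g (lie X Z) Y - g (lie Y Z) X : C).

Lemma koszul_linear X Y : module_linear (koszul X Y).
Proof.
move=> f Z Z'; apply: smoothFunP => q; rewrite /koszul !lie_lr.
rewrite !gDl !gDr !gZl !gZr !vfD !vfM !vfaddE !vfscaleE !evE.
rewrite (metric_sym g X Z) (metric_sym g Y Z); ring.
Qed.

Lemma half_double (a : R) : 2^-1 * (a + a) = a.
Proof.
by rewrite -mulr2n -[a *+ 2]mulr_natl mulrA mulVf ?mul1r// pnatr_eq0.
Qed.

(** The Koszul expression is linear over functions in its last argument, so [sharp] converts it into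
    the field D_X Y; the connection axioms are then checked against an arbitrary [W]. *)
Lemma levi_civita_exists : framed M -> exists D, levi_civita g D.
Proof.
move=> fr.
have /choice[nab0 H] X : exists nX : VF -> VF, forall Y Z,
    g (nX Y) Z = koszul X Y Z.
  by have /choice[nX HX] Y := @sharp _ _ g fr _ (koszul_linear X Y); exists nX.
pose nab X Y := nab0 X Y.
have gE X Y Z q : g (nab X Y) Z q = 2^-1 * ((X (g Y Z) : C) q +
  (Y (g X Z) : C) q - (Z (g X Y) : C) q + g (lie X Y) Z q - g (lie X Z) Y q -
  g (lie Y Z) X q) by rewrite H.
have lin f X Y Z : nab (f *: X + Y) Z = f *: nab X Z + nab Y Z.
  apply: (@metric_inj _ _ _ g) => W; apply: smoothFunP => q.
  rewrite gDl gZl !evE !gE !lie_ll.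
  rewrite !gDl !gNl !gZl !gDr !gZr !vfD !vfM !vfaddE !vfscaleE !evE.
  by ring.
have add X Y Z : nab X (Y + Z) = nab X Y + nab X Z.
  apply: (@metric_inj _ _ _ g) => W; apply: smoothFunP => q.
  rewrite gDl !evE !gE -[Y]scale1r lie_lr lie_ll !scale1r.
  rewrite !vf1 !scale0r add0r subr0 !gDl !gDr !vfD !vfaddE !evE; ring.
have leib f X Y : nab X (f *: Y) = (X f : C) *: Y + f *: nab X Y.
  apply: (@metric_inj _ _ _ g) => W; apply: smoothFunP => q.
  rewrite gDl !gZl !evE !gE -[f *: Y]addr0 lie_lr lie_ll addr0.
  have -> : lie X 0 = 0 by apply: vfP => h q'; rewrite lieE vfzeroE vf0 subr0.
  have -> : lie 0 W = 0 by apply: vfP => h q'; rewrite lieE vfzeroE vf0 subr0.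
  rewrite !addr0 gDl gBl !gZl !gZr !vfM !vfscaleE !evE (metric_sym g Y X).
  have := half_double ((X f : C) q * g Y W q).
  lra.
exists (AffineConnection lin add leib); split=> [X Y|X Y Z] /=.
  apply: (@metric_inj _ _ _ g) => W; apply: smoothFunP => q.
  rewrite gBl !evE !gE (lieNC Y X) gNl evN (metric_sym g Y X).
  have := half_double (g (lie X Y) W q); lra.
apply: smoothFunP => q.
rewrite evD (metric_sym g Y (nab X Z)) !gE (lieNC Z Y) gNl evN.
rewrite (metric_sym g Z Y).
have := half_double ((X (g Y Z) : C) q); lra.
Qed.

End LeviCivita.

(** * From coKahler structures to parallel endomorphisms *)

(* T X Y Z stands for g ((D_X theta) Y) Z at a point, and h X Y for
   g (D_X xi) Y; the hypotheses are the algebraic consequences of dOmega = 0,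
   N = 0, theta^2 = -1 + eta xi and deta = 0. *)
Lemma coKahler_algebra {R : realType} {V : Type} (T : V -> V -> V -> R)
    (h : V -> V -> R) (eta : V -> R) (th : V -> V) (xi : V) :
  (forall X Y Z, T X Y Z = - T X Z Y) ->
  (forall X Y Z, T X Y Z + T Y Z X + T Z X Y = 0) ->
  (forall X Y Z,
    T (th X) Y Z - T (th Y) X Z - T Y X (th Z) + T X Y (th Z) = 0) ->
  (forall X Y Z, T X (th Y) Z - T X Y (th Z) = h X Y * eta Z + eta Y * h X Z) ->
  (forall X Z, T X xi Z = h X (th Z)) ->
  (forall X Z, T (th xi) X Z = 0) ->
  (forall X Y, h X Y = h Y X) ->
  (forall X Z, h X (th (th Z)) = - h X Z) ->
  (forall X Y Z, T X Y (th (th Z)) = - T X Y Z + eta Z * T X Y xi) ->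
  forall X Y Z, T X Y Z = 0.
Proof.
move=> skew cyc nij sq Txi T0 hC hth Tth.
(* Normality at [xi] gives T xi X (th Z) = h (th X) (th Z) - h X Z, while the cyclic relation gives
   -h (th X) (th Z) - h X Z; comparing them leaves 2 h (th X) (th Z) = 0. *)
have hh X Z : h (th X) (th Z) = 0.
  have := nij xi X Z; rewrite !Txi T0 hth.
  have := nij X xi Z; rewrite !Txi T0 hth.
  have := cyc X (th Z) xi; rewrite (skew X (th Z) xi) !Txi hth.
  by rewrite (hC (th Z)); lra.
have h0 X Y : h X Y = 0.
  have := hh (th X) (th Y); rewrite hth hC hth; have := hC X Y; lra.
have Txi0 X Y : T X Y xi = 0 by rewrite skew Txi h0 oppr0.
have A X Y Z : T X (th Y) Z = T X Y (th Z).
  by have := sq X Y Z; rewrite !h0; lra.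
have As X Y Z : T X Y (th Z) = - T X Z (th Y) by rewrite -A skew.
(* The cyclic relation moves [th] out of the differentiation slot of [nij]; the antisymmetry [As]
   then cancels everything except -2 T Z X (th Y). *)
have K X Y Z : T Z X (th Y) = 0.
  have := nij X Y Z; have := cyc (th X) Y Z; have := cyc (th Y) X Z.
  have := A Z X Y; have := A Z Y X.
  have := As Y Z X; have := As X Z Y; have := As Z Y X; lra.
by move=> X Y Z; have := Tth X Y Z; rewrite K Txi0; lra.
Qed.

Section CoKahlerParallel.
Context {R : realType} (M : manifold R 3) (S : almost_contact_metric M).
Local Notation C := (smoothFun M).
Local Notation VF := (vectorField M).
Implicit Types (p q : M) (f : C) (W X Y Z : VF) (D : affine_connection M).
Local Notation g := (acm_g S).
Local Notation xi := (acm_xi S).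
Local Notation eta := (acm_eta S).
Local Notation th := (acm_theta S).

Lemma d1_ev (a : form1 M) X Y q : d1 a X Y q =
  (X (a Y) : C) q - (Y (a X) : C) q - (a (lie X Y) : C) q.
Proof. by []. Qed.

Lemma d2_ev (Om : VF -> VF -> C) X Y Z q : d2 Om X Y Z q =
  (X (Om Y Z) : C) q + (Y (Om Z X) : C) q + (Z (Om X Y) : C) q
  - Om (lie X Y) Z q - Om (lie Y Z) X q - Om (lie Z X) Y q.
Proof. by []. Qed.

Lemma coKahler_parallel D : levi_civita g D -> coKahler S -> parallel D th.
Proof.
move=> [tf mc] [[deta dOm] nor].
have tfE X Y : lie X Y = D X Y - D Y X by rewrite tf.
have sk := acm_skew S.
have mcE X Y Z q : (X (g Y Z) : C) q = g (D X Y) Z q + g Y (D X Z) q.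
  by rewrite mc evD.
have skq X Y q : g (th X) Y q = - g X (th Y) q by rewrite sk evN.
have skr X Y q : g X (th Y) q = - g (th X) Y q by rewrite skq opprK.
have skC X Y q : g (th X) Y q = - g (th Y) X q by rewrite skq metric_sym.
move=> X Y; apply: (@metric_inj _ _ _ g) => Z; apply: smoothFunP => q.
rewrite g0l ev0; move: X Y Z.
pose h X Y := g (D X xi) Y q.
have hxi X : h X xi = 0.
  have := mcE X xi xi q; rewrite metric_xi acm_eta_xi vf1 ev0.
  by rewrite (metric_sym g xi) /h; lra.
have th2 W Z : g W (th (th Z)) q = - g W Z q + eta Z q * g W xi q.
  by rewrite acm_theta2 gDr gNr gZr !evE.
apply: (@coKahler_algebra R VF (fun X Y Z => g (cov_endo D th X Y) Z q) h
  (fun X => eta X q) th xi).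
- move=> X Y Z; rewrite /cov_endo !gBl !evE !(skC (D X _)).
  have m1 := mcE X (th Y) Z q; have m2 := mcE X Y (th Z) q.
  rewrite sk vfN evN in m1; rewrite (metric_sym g Y (D X (th Z))) in m2.
  rewrite (metric_sym g (D X Y)) in m2; lra.
- move=> X Y Z; have : d2 (fundamental_form S) X Y Z q = 0 by rewrite dOm.
  rewrite d2_ev /fundamental_form /cov_endo !tfE !linearB /= !gBl !evE !mcE.
  rewrite (skC Y (D X Z)) (skC Z (D Y X)) (skC X (D Z Y)); lra.
- move=> X Y Z; have := congr1 (fun W => g W Z q) (nor X Y).
  rewrite deta scale0r addr0 g0l ev0 /nijenhuis !tfE /cov_endo.
  rewrite !(linearB, linearD) /= ?linearB /= !(gDl, gNl, evE, skr).
  rewrite !linearB /= !(gDl, gNl, evE); lra.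
(* This is the covariant derivative of theta^2 = -1 + eta xi, with eta written as the pairing with
   [xi]. *)
- move=> X Y Z; rewrite /cov_endo !gBl !evE !skr.
  have := congr1 (fun W => g W Z q) (congr1 (D X) (acm_theta2 S Y)).
  rewrite nablaDr nablaNr nablaZr !gDl gNl !gZl -(metric_xi S Y) !evE mcE.
  rewrite (acm_theta2 S (D X Y)) gDl gNl gZl !evE.
  rewrite -!metric_xi (metric_sym g xi Z) (metric_sym g Y (D X xi)) /h; lra.
- by move=> X Z; rewrite /cov_endo theta_xi nabla0r sub0r gNl evN skq opprK.
- move=> X Z; rewrite /cov_endo theta_xi.
  have D0 W : D 0 W = 0.
    have := nabla_linear D (-1) 0 0 W.
    by rewrite scaler0 addr0 scaleN1r addNr.
  by rewrite !D0 linear0 subrr g0l.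
- move=> X Y; have : d1 eta X Y q = 0 by rewrite deta.
  rewrite d1_ev -!metric_xi !mcE tfE gBl !evE.
  by rewrite (metric_sym g X (D Y xi)) (metric_sym g Y (D X xi)) /h; lra.
- by move=> X Z; rewrite /h th2 -/(h X xi) hxi mulr0 addr0.
- by move=> X Y Z; rewrite th2.
Qed.

End CoKahlerParallel.

(** If theta were 0, every field would be a multiple of [xi], and the identity matrix of a frame in
    its own coordinates would have rank one: the entries (0,1), (0,0) and (1,1) contradict each
    other. *)
Lemma acm_theta_neq0 {R : realType} (M : manifold R 3)
    (S : almost_contact_metric M) : framed M -> exists X, acm_theta S X <> 0.
Proof.
move=> fr; apply: contrapT => /forallNP th0.
have {}th0 X : acm_theta S X = 0 by apply: contrapT; exact: th0.
have XE X : X = acm_eta S X *: acm_xi S.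
  have := acm_theta2 S X; rewrite th0 => /eqP.
  by rewrite eq_sym addrC subr_eq0 => /eqP.
have [p _] := @manifold_nonempty _ _ M.
have [X [y [V [[_ Xy _] Vp]]]] := fr p.
have E i j : acm_eta S (X i) p * (acm_xi S (y j) : smoothFun M) p = (i == j)%:R.
  by rewrite -(Xy p i j Vp) {2}(XE (X i)) vfscaleE.
have /eqP := E o0 o1; rewrite mulf_eq0 => /orP[]/eqP z.
  by have /eqP := E o0 o0; rewrite z mul0r eq_sym oner_eq0.
by have /eqP := E o1 o1; rewrite z mulr0 eq_sym oner_eq0.
Qed.

Theorem theorem3p12 (R : realType) (M : manifold R 3)
    (M_connected : connected [set: M]) (M_orientable : orientable M) :
  (exists S : almost_contact_metric M, coKahler S) <->
  (exists (g : riemannian_metric M) (D : affine_connection M),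
    levi_civita g D /\
    exists theta : endo M,
      [/\ exists X, theta X <> 0, skew_symmetric g theta & parallel D theta]).
Proof.
have fr := orientable_framed M_orientable; split.
  move=> [S KS]; have [D LC] := levi_civita_exists (acm_g S) fr.
  exists (acm_g S), D; split=> //; exists (acm_theta S); split.
  - exact: acm_theta_neq0.
  - exact: acm_skew.
  - exact: coKahler_parallel LC KS.
move=> [g [D [LC [theta [theta0 skew par]]]]].
exact: (coKahler_exists M_connected M_orientable LC skew par theta0).
Qed.
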